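(* There exist $\sigma\in(0,1)$ and $\bar C>0$ depending only on $N,p,s$ such that: if $R>0$, $K\ge0$, and $u\in\widetilde W^{s,p}(B_{R/3})$ satisfies $(-\Delta)^s_pu\ge-K$ weakly in $B_{R/3}$ and $u\ge0$ a.e. in $\mathbb R^N$, then $$\operatorname*{ess\,inf}_{B_{R/4}}u\ge\sigma\Big(\frac1{|B_R\setminus B_{R/2}|}\int_{B_R\setminus B_{R/2}}u^{p-1}dx\Big)^{\frac1{p-1}}-\bar C(KR^{ps})^{\frac1{p-1}}.$$
   Context: Fixed $s\in(0,1)$, $p\in(1,\infty)$; balls centered at $0$. $a^q:=|a|^{q-1}a$. $\widetilde W^{s,p}(\Omega)$ (bounded open $\Omega$): $u\in L^p_{loc}(\mathbb R^N)$ with $u\in W^{s,p}(U)$ for some bounded open $U\supset\overline\Omega$ and $\int_{\mathbb R^N}\frac{|u|^{p-1}}{(1+|x|)^{N+ps}}dx<\infty$. ''$(-\Delta)^s_pu\ge-K$ weakly in $\Omega$'' means $\int_{\mathbb R^N\times\mathbb R^N}\frac{(u(x)-u(y))^{p-1}(\varphi(x)-\varphi(y))}{|x-y|^{N+ps}}dxdy\ge-K\int_\Omega\varphi$ for all $\varphi\in W^{s,p}_0(\Omega)$, $\varphi\ge0$. *)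

(* Defs.v *)
(* R^N is modelled as N.-tuple R, equipped with the
   product (= Borel) sigma-algebra of the library.  N-dimensional Lebesgue
   integrals of nonnegative functions are defined as iterated one-dimensional
   Lebesgue integrals (Tonelli), which agrees with the N-dim Lebesgue integral
   for Borel measurable integrands. *)
From HB Require Import structures.
From mathcomp Require Import all_boot all_order all_algebra.
From mathcomp Require Import all_classical all_reals all_analysis.
Set Implicit Arguments. Unset Strict Implicit. Unset Printing Implicit Defensive.
Import Order.TTheory GRing.Theory Num.Theory.
Import numFieldNormedType.Exports.
Local Open Scope classical_set_scope.
Local Open Scope ring_scope.

Section Frac.
Variable R : realType.

Fixpoint iint (n : nat) : (n.-tuple R -> \bar R) -> \bar R :=
  match n return (n.-tuple R -> \bar R) -> \bar R with
  | 0 => fun f => f [tuple]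
  | n'.+1 => fun f =>
      (\int[@lebesgue_measure R]_x iint (fun t : n'.-tuple R => f (cons_tuple x t)))%E
  end.

Definition lebN (N : nat) (A : set (N.-tuple R)) : \bar R :=
  iint (fun x => (\1_A x)%:E).

Definition intN (N : nat) (A : set (N.-tuple R)) (f : N.-tuple R -> R) : \bar R :=
  iint (fun x => (\1_A x * f x)%:E).

Definition dintN (N : nat) (F : N.-tuple R -> N.-tuple R -> R) : \bar R :=
  (iint (fun x => iint (fun y => (Num.max (F x y) 0)%R%:E))
   - iint (fun x => iint (fun y => (Num.max (- F x y) 0)%R%:E)))%E.

Definition edist (N : nat) (x y : N.-tuple R) : R :=
  Num.sqrt (\sum_(i < N) (tnth x i - tnth y i) ^+ 2).
Definition enorm (N : nat) (x : N.-tuple R) : R :=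
  Num.sqrt (\sum_(i < N) (tnth x i) ^+ 2).

Definition eball0 (N : nat) (r : R) : set (N.-tuple R) := [set x | enorm x < r].
Definition eball (N : nat) (c : N.-tuple R) (r : R) : set (N.-tuple R) :=
  [set x | edist x c < r].

Definition eopen (N : nat) (U : set (N.-tuple R)) : Prop :=
  forall x, U x -> exists2 e : R, 0 < e & eball x e `<=` U.
Definition ebounded (N : nat) (U : set (N.-tuple R)) : Prop :=
  exists r : R, U `<=` @eball0 N r.
Definition eclosure (N : nat) (U : set (N.-tuple R)) : set (N.-tuple R) :=
  [set x | forall e : R, 0 < e -> eball x e `&` U !=set0].

Definition ae_in (N : nat) (A : set (N.-tuple R)) (P : N.-tuple R -> Prop) : Prop :=
  lebN [set x | A x /\ ~ P x] = 0%E.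

Definition spow (a q : R) : R := (`|a| `^ (q - 1)) * a.

Definition Wsp (N : nat) (s p : R) (U : set (N.-tuple R)) (u : N.-tuple R -> R) : Prop :=
  measurable_fun [set: N.-tuple R] u /\
  (intN U (fun x => `|u x| `^ p)%R < +oo)%E /\
  (iint (fun x => iint (fun y =>
     (\1_U x * \1_U y * (`|u x - u y| `^ p / edist x y `^ (N%:R + s * p)))%R%:E))
   < +oo)%E.

Definition Lploc (N : nat) (p : R) (u : N.-tuple R -> R) : Prop :=
  measurable_fun [set: N.-tuple R] u /\
  forall r : R, 0 < r -> (intN (@eball0 N r) (fun x => `|u x| `^ p)%R < +oo)%E.

Definition tWsp (N : nat) (s p : R) (Om : set (N.-tuple R)) (u : N.-tuple R -> R) : Prop :=
  Lploc p u /\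
  (exists U, eopen U /\ ebounded U /\ eclosure Om `<=` U /\ Wsp s p U u) /\
  (intN setT (fun x => `|u x| `^ (p - 1) / (1 + enorm x) `^ (N%:R + p * s))%R < +oo)%E.

Definition W0sp (N : nat) (s p : R) (Om : set (N.-tuple R)) (phi : N.-tuple R -> R) : Prop :=
  Wsp s p setT phi /\ ae_in (~` Om) (fun x => phi x = 0).

Definition weak_super (N : nat) (s p K : R) (Om : set (N.-tuple R)) (u : N.-tuple R -> R) : Prop :=
  forall phi : N.-tuple R -> R, W0sp s p Om phi -> (forall x, 0 <= phi x) ->
    (dintN (fun x y => spow (u x - u y) (p - 1) * (phi x - phi y)
                        / edist x y `^ (N%:R + p * s))%R
     >= - (K%:E * intN Om phi))%E.

Definition essinf (N : nat) (A : set (N.-tuple R)) (u : N.-tuple R -> R) : \bar R :=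
  ereal_sup [set c%:E | c in [set c : R | ae_in A (fun x => c <= u x)]].

End Frac.
Arguments eball0 {R} N r.

(* Main.v *)
(** A De Giorgi iteration without barrier estimates for the operator. Compare u with the truncated
    cones v_th = (48 m (7/24 - |x|/Rad) - th m)^+, 0 <= th <= 1, where m is sigma times the average
    on the right, and test the equation with (v_th - u)^+. Since v_th is Lipschitz with constant
    48 m / Rad, a Caccioppoli estimate bounds the energy of (v_th - u)^+ by C m^p Rad^(-ps) |A_th|,
    A_th = {u < v_th}. The annulus contributes a good term proportional to the integral of u^(p-1)
    times |A_1/2|, which makes |A_1/2| <= C sigma^(p-1) Rad^N. If A_th fills at most half of every
    cube of side 2r, the energy bounds (th' - th)^p r^(-ps) |A_th'| from below up to constants; with
    th_j = 1 - 2^-(j+1) and r_j proportional to 2^(-j/s) the volumes |A_th_j| decay geometrically,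
    so A_1 is a null set, and u >= m a.e. on the ball of radius Rad/4. *)
From Pilot Require Import Defs.
From HB Require Import structures.
From mathcomp Require Import all_boot all_order all_algebra.
From mathcomp Require Import all_classical all_reals all_analysis.
From mathcomp Require Import measurable_realfun.
From mathcomp Require Import ring lra.
Import Order.TTheory GRing.Theory Num.Theory.
Import numFieldNormedType.Exports.
(* The library has another [edist]. *)
Import Pilot.Defs.
Local Open Scope classical_set_scope.
Local Open Scope ring_scope.
Set Implicit Arguments. Unset Strict Implicit. Unset Printing Implicit Defensive.

(** * Iterated Lebesgue integrals: additivity, Tonelli exchange and null sets *)

Section IteratedIntegral.
Context {R : realType}.
Local Open Scope ereal_scope.
Implicit Types n m : nat.

(** The decay estimate replaces a Sobolev inequality: near each point of A_th' there is, at distance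
    below (N + 1) r, a set of at least half the volume of a cube on which (v_th - u)^+ vanishes. The
    resulting bound is only linear in the volume |A_th|, so it has none of the usual gain of
    exponent. The gain comes from the free choice of r, since the factor contains (r / Rad)^(ps). A
    smaller r demands a smaller volume beforehand, and the parameters are tuned so that volumes and
    cubes contract at the same rate. Such an iteration must start from a small set, and only the
    long-range interaction supplies one: for y in the annulus the test function vanishes, and large
    values of u(y) make u(x) - u(y) very negative for x in A_th. The negative term that the
    Caccioppoli estimate would discard is kept there. The cases p < 2 and p >= 2 are never
    separated; the pointwise inequalities compare the sizes of two numbers instead. *)

Lemma iint_ge0 n (f : n.-tuple R -> \bar R) :
  (forall x, 0 <= f x) -> 0 <= iint f.
Proof.
elim: n f => [|n IH] f f0 //=; apply: integral_ge0 => x _; exact: IH.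
Qed.

(** The parameter space [T] is arbitrary so that the induction can move the first coordinate of the
    tuple into it; each step is then Tonelli for one real variable. *)
Lemma measurable_iint d (T : measurableType d) n (f : T -> n.-tuple R -> \bar R) :
  measurable_fun setT (fun z : T * n.-tuple R => f z.1 z.2) ->
  (forall x y, 0 <= f x y) ->
  measurable_fun setT (fun x => iint (f x)).
Proof.
elim: n d T f => [|n IH] d T f mf f0 /=.
  rewrite (_ : (fun x => f x [tuple]) = (fun z : T * 0.-tuple R => f z.1 z.2) \o (fun x => (x, [tuple]))) //.
  apply: measurableT_comp => //; exact: measurable_fun_pair.
have mg : measurable_fun setT (fun z : T * R => iint (fun t : n.-tuple R => f z.1 (cons_tuple z.2 t))).
  apply: IH => //.
  rewrite (_ : (fun _ => _) = (fun z : T * n.+1.-tuple R => f z.1 z.2) \o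
    (fun z : T * R * n.-tuple R => (z.1.1, cons_tuple z.1.2 z.2))) //.
  apply: measurableT_comp => //; apply: measurable_fun_pair.
    exact: measurableT_comp.
  apply: (measurable_cons (f := fun z : T * R * n.-tuple R => z.1.2)) => //.
  exact: measurableT_comp.
apply: (@measurable_fun_fubini_tonelli_F _ _ _ _ _ (@lebesgue_measure R) _ mg).
by move=> z; exact: iint_ge0.
Qed.

Lemma measurable_iint_cons n (f : n.+1.-tuple R -> \bar R) :
  measurable_fun setT f -> (forall x, 0 <= f x) ->
  measurable_fun setT (fun x : R => iint (fun t : n.-tuple R => f (cons_tuple x t))).
Proof.
move=> mf f0; apply: (measurable_iint (f := fun x (t : n.-tuple R) => f (cons_tuple x t))) => //.
apply: (measurableT_comp mf).
apply: (measurable_cons (f := fun z : R * n.-tuple R => z.1)); [exact: measurable_fst|exact: measurable_snd].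
Qed.

Lemma measurable_cons_section n (f : n.+1.-tuple R -> \bar R) (x : R) :
  measurable_fun setT f -> measurable_fun setT (fun t : n.-tuple R => f (cons_tuple x t)).
Proof.
move=> mf; apply: (measurableT_comp mf).
exact: (measurable_cons (f := fun _ : n.-tuple R => x)).
Qed.

(** The integral of a nonnegative function is a supremum over the simple functions below it, and a
    larger function admits more of them. Later comparisons of integrals therefore carry no
    measurability conditions. *)
Lemma le_integral_nonmeasurable d (T : measurableType d)
    (mu : {measure set T -> \bar R}) (f g : T -> \bar R) :
  (forall x, 0 <= f x) -> (forall x, f x <= g x) ->
  \int[mu]_x f x <= \int[mu]_x g x.
Proof.
move=> f0 fg; have g0 x : 0 <= g x by apply: le_trans (fg x).
rewrite !ge0_integralTE//; apply: le_ereal_sup => _ [h hf <-]; exists h => // x.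
exact: le_trans (fg x).
Qed.

Lemma le_iint n (f g : n.-tuple R -> \bar R) :
  (forall x, 0 <= f x) -> (forall x, f x <= g x) -> iint f <= iint g.
Proof.
elim: n f g => [|n IH] f g f0 fg //=.
by apply: le_integral_nonmeasurable => x; [exact: iint_ge0|exact: IH].
Qed.

Lemma iintD n (f g : n.-tuple R -> \bar R) :
  measurable_fun setT f -> measurable_fun setT g ->
  (forall x, 0 <= f x) -> (forall x, 0 <= g x) ->
  iint (fun x => f x + g x) = iint f + iint g.
Proof.
elim: n f g => [|n IH] f g mf mg f0 g0 //=.
rewrite -ge0_integralD//; try by [move=> x _; exact: iint_ge0 | exact: measurable_iint_cons].
by apply: eq_integral => x _; rewrite IH//; exact: measurable_cons_section.
Qed.

Lemma iintZ n (k : R) (f : n.-tuple R -> \bar R) :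
  measurable_fun setT f -> (forall x, 0 <= f x) -> (0 <= k)%R ->
  iint (fun x => k%:E * f x) = k%:E * iint f.
Proof.
elim: n f => [|n IH] f mf f0 k0 //=.
rewrite -ge0_integralZl_EFin//; try by [move=> x _; exact: iint_ge0 | exact: measurable_iint_cons].
by apply: eq_integral => x _; rewrite IH//; exact: measurable_cons_section.
Qed.

Lemma iint0 n : iint (fun _ : n.-tuple R => 0) = 0 :> \bar R.
Proof. by elim: n => //= n ->; rewrite integral0. Qed.

Lemma iint_nneseries n (f : nat -> n.-tuple R -> \bar R) :
  (forall k, measurable_fun setT (f k)) -> (forall k x, 0 <= f k x) ->
  iint (fun x => \sum_(k <oo) f k x) = \sum_(k <oo) iint (f k).
Proof.
elim: n f => [|n IH] f mf f0 //=.
rewrite -integral_nneseries//; try by [move=> k x _; exact: iint_ge0 | move=> k; exact: measurable_iint_cons].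
by apply: eq_integral => x _; rewrite IH// => k; exact: measurable_cons_section.
Qed.

(** Each induction step is Tonelli for two real variables. [iint_exchange] applies the result to the
    coordinates of its first argument, one at a time. *)
Lemma iint_integral_exchange n (f : R -> n.-tuple R -> \bar R) :
  measurable_fun setT (fun z : R * n.-tuple R => f z.1 z.2) ->
  (forall x y, 0 <= f x y) ->
  \int[@lebesgue_measure R]_x iint (f x) =
  iint (fun y => \int[@lebesgue_measure R]_x f x y).
Proof.
elim: n f => [|n IH] f mf f0 //=.
have mf3 : measurable_fun setT
    (fun z : R * R * n.-tuple R => f z.1.1 (cons_tuple z.1.2 z.2)).
  rewrite (_ : (fun _ => _) = (fun z : R * n.+1.-tuple R => f z.1 z.2) \o
    (fun z : R * R * n.-tuple R => (z.1.1, cons_tuple z.1.2 z.2))) //.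
  apply: measurableT_comp => //; apply: measurable_fun_pair.
    exact: measurableT_comp.
  apply: (measurable_cons (f := fun z : R * R * n.-tuple R => z.1.2)) => //.
  exact: measurableT_comp.
have mg : measurable_fun setT
    (fun z : R * R => iint (fun t : n.-tuple R => f z.1 (cons_tuple z.2 t))).
  exact: (measurable_iint (f := fun z : R * R => fun t : n.-tuple R => f z.1 (cons_tuple z.2 t))).
have := @fubini_tonelli _ _ _ _ _ (@lebesgue_measure R) (@lebesgue_measure R) _ mg.
rewrite /fubini_F /fubini_G /= => ->; last by move=> z; exact: iint_ge0.
apply: eq_integral => t _; rewrite IH//.
apply: (measurableT_comp mf3 (g := fun z : R * n.-tuple R => ((z.1, t), z.2))).
apply: measurable_fun_pair => //; exact: measurable_fun_pair.
Qed.

Lemma iint_exchange n m (f : n.-tuple R -> m.-tuple R -> \bar R) :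
  measurable_fun setT (fun z : n.-tuple R * m.-tuple R => f z.1 z.2) ->
  (forall x y, 0 <= f x y) ->
  iint (fun x => iint (f x)) = iint (fun y => iint (f ^~ y)).
Proof.
elim: n f => [|n IH] f mf f0 //=.
have mf3 : measurable_fun setT
    (fun z : R * m.-tuple R * n.-tuple R => f (cons_tuple z.1.1 z.2) z.1.2).
  rewrite (_ : (fun _ => _) = (fun z : n.+1.-tuple R * m.-tuple R => f z.1 z.2) \o
    (fun z : R * m.-tuple R * n.-tuple R => (cons_tuple z.1.1 z.2, z.1.2))) //.
  apply: measurableT_comp => //; apply: measurable_fun_pair; last exact: measurableT_comp.
  apply: (measurable_cons (f := fun z : R * m.-tuple R * n.-tuple R => z.1.1)) => //.
  exact: measurableT_comp.
have -> : (fun y => \int[@lebesgue_measure R]_x iint (fun t : n.-tuple R => f (cons_tuple x t) y)) =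
  (fun y => \int[@lebesgue_measure R]_x
     (fun (x : R) (y : m.-tuple R) => iint (fun t : n.-tuple R => f (cons_tuple x t) y)) x y) by [].
rewrite -iint_integral_exchange; last 2 first.
- exact: (measurable_iint (f := fun (z : R * m.-tuple R) t => f (cons_tuple z.1 t) z.2)).
- by move=> x y; exact: iint_ge0.
apply: eq_integral => x _; rewrite IH//.
apply: (measurableT_comp mf3 (g := fun z : n.-tuple R * m.-tuple R => ((x, z.2), z.1))).
apply: measurable_fun_pair => //; exact: measurable_fun_pair.
Qed.

(** Adding infinity on B to one function makes it dominate the other everywhere. Infinity is written
    as a series of copies of the indicator of B, whose integral is a series of zeros, so no product
    measure is required. By symmetry one inequality suffices. *)
Lemma eq_iint_null n (B : set (n.-tuple R)) (f g : n.-tuple R -> \bar R) :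
  measurable B -> lebN B = 0 ->
  measurable_fun setT f -> measurable_fun setT g ->
  (forall x, 0 <= f x) -> (forall x, 0 <= g x) ->
  (forall x, ~ B x -> f x = g x) -> iint f = iint g.
Proof.
move=> mB B0.
suff H (f' g' : n.-tuple R -> \bar R) : measurable_fun setT f' -> measurable_fun setT g' ->
    (forall x, 0 <= f' x) -> (forall x, 0 <= g' x) ->
    (forall x, ~ B x -> f' x = g' x) -> iint f' <= iint g'.
  move=> mf mg f0 g0 fg; apply/eqP; rewrite eq_le !H// => x Bx.
  by rewrite fg.
move=> mf mg f0 g0 fg.
have mi : measurable_fun setT (fun x => (\1_B x)%:E : \bar R).
  by apply/measurable_EFinP; exact: measurable_indic.
have h0 (k : nat) x : 0 <= (fun _ x => (\1_B x)%:E : \bar R) k x.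
  by rewrite lee_fin.
have mS : measurable_fun setT (fun x => \sum_(k <oo) (fun (k : nat) x => (\1_B x)%:E : \bar R) k x).
  apply: ge0_emeasurable_sum => // *; exact: h0.
have S0 x : 0 <= \sum_(k <oo) (fun (k : nat) x => (\1_B x)%:E : \bar R) k x.
  by apply: nneseries_ge0 => k _ _; exact: h0.
apply: (@le_trans _ _ (iint (fun x => g' x + \sum_(k <oo) (fun (k : nat) x => (\1_B x)%:E : \bar R) k x))).
  apply: le_iint => // x; have [Bx|Bx] := pselect (B x); last by rewrite fg// leeDl.
  suff -> : \sum_(k <oo) (\1_B x)%:E = +oo :> \bar R by rewrite addey ?leey// gt_eqF// (lt_le_trans _ (g0 x)).
  apply/eqyP => A A0.
  apply: (@le_trans _ _ (\sum_(0 <= k < (Num.trunc A).+1) (\1_B x)%:E)); last first.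
    exact: nneseries_lim_ge.
  rewrite sumEFin lee_fin indicE mem_set// big_const_nat subn0 iter_addr_0.
  exact/ltW/truncnS_gt.
rewrite iintD//.
have -> : iint (fun x => \sum_(k <oo) (fun (k : nat) x => (\1_B x)%:E : \bar R) k x) = 0.
  by rewrite (iint_nneseries (f := fun (k : nat) x => (\1_B x)%:E : \bar R))// eseries0.
by rewrite adde0.
Qed.

End IteratedIntegral.

(** * Measurability of distances, norms and powers *)

Section EuclideanMeasurability.
Context {R : realType} {N : nat}.
Context d {T : measurableType d}.
Implicit Types f g : T -> R.

Lemma measurable_set_ltr f g : measurable_fun setT f -> measurable_fun setT g ->
  measurable [set x | f x < g x].
Proof.
move=> mf mg; have := measurable_fun_ltr mf mg measurableT (Y := [set true]) I.
by rewrite setTI.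
Qed.

Lemma measurable_sqrt_comp f : measurable_fun setT f ->
  measurable_fun setT (fun x => Num.sqrt (f x)).
Proof.
move=> mf; apply: (measurableT_comp (f := @Num.sqrt R)) mf.
by apply: continuous_measurable_fun; exact: sqrt_continuous.
Qed.

Lemma measurable_powR_comp f (a : R) : measurable_fun setT f ->
  measurable_fun setT (fun x => f x `^ a).
Proof. exact: (measurableT_comp (measurable_powR a)). Qed.

Lemma measurable_tnth_comp (h : T -> N.-tuple R) i : measurable_fun setT h ->
  measurable_fun setT (fun x => tnth (h x) i).
Proof. exact: (measurableT_comp (measurable_tnth i)). Qed.

Lemma measurable_edist (h k : T -> N.-tuple R) :
  measurable_fun setT h -> measurable_fun setT k ->
  measurable_fun setT (fun x => edist (h x) (k x)).
Proof.
move=> mh mk; apply: measurable_sqrt_comp; apply: measurable_sum => i.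
apply: measurable_funX; apply: measurable_funB; exact: measurable_tnth_comp.
Qed.

Lemma measurable_enorm (h : T -> N.-tuple R) :
  measurable_fun setT h -> measurable_fun setT (fun x => enorm (h x)).
Proof.
move=> mh; apply: measurable_sqrt_comp; apply: measurable_sum => i.
by apply: measurable_funX; exact: measurable_tnth_comp.
Qed.

Lemma measurable_indic_comp d' (T' : measurableType d') (h : T -> T') (A : set T') :
  measurable A -> measurable_fun setT h ->
  measurable_fun setT (fun x => \1_A (h x) : R).
Proof. by move=> mA; apply: (measurableT_comp (f := \1_A : T' -> R)); exact: measurable_indic. Qed.

End EuclideanMeasurability.

(** * Euclidean metric on tuples, volumes of cubes and balls *)

Section EuclideanGeometry.
Context {R : realType}.
Implicit Types N : nat.

Lemma edist_ge0 N (x y : N.-tuple R) : 0 <= edist x y.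
Proof. exact: sqrtr_ge0. Qed.

Lemma enorm_ge0 N (x : N.-tuple R) : 0 <= enorm x.
Proof. exact: sqrtr_ge0. Qed.

Lemma edistC N (x y : N.-tuple R) : edist x y = edist y x.
Proof.
by rewrite /edist; congr Num.sqrt; apply: eq_bigr => i _; rewrite -sqrrN opprB.
Qed.

Lemma edistxx N (x : N.-tuple R) : edist x x = 0.
Proof. by rewrite /edist big1 ?sqrtr0// => i _; rewrite subrr expr0n. Qed.

Lemma norm_tnth_le_edist N (x y : N.-tuple R) i : `|tnth x i - tnth y i| <= edist x y.
Proof.
rewrite -sqrtr_sqr /edist ler_wsqrtr// (bigD1 i)//= lerDl sumr_ge0// => j _.
exact: sqr_ge0.
Qed.

Lemma edist_le_max N (x y : N.-tuple R) (r : R) : 0 <= r ->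
  (forall i, `|tnth x i - tnth y i| <= r) -> edist x y <= N%:R * r.
Proof.
move=> r0 xyr; rewrite -[leRHS]ger0_norm ?mulr_ge0// -sqrtr_sqr ler_wsqrtr//.
apply: (@le_trans _ _ (\sum_(i < N) r ^+ 2)).
  apply: ler_sum => i _; rewrite -real_normK ?num_real//.
  by rewrite ler_pXn2r ?nnegrE.
rewrite sumr_const card_ord exprMn -[leLHS]mulr_natl.
apply: ler_wpM2r; first exact: sqr_ge0.
by rewrite expr2 -natrM ler_nat; case: N {x y xyr} => // N; rewrite leq_pmulr.
Qed.

(** With A, B, C the three sums, the squares (A b_i - C a_i)^2 add up to A (A B - C^2). This settles
    A > 0; when A = 0 all [a i] vanish. *)
Lemma cauchy_schwarz_sum N (a b : 'I_N -> R) :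
  (\sum_(i < N) a i * b i) ^+ 2 <= (\sum_(i < N) a i ^+ 2) * (\sum_(i < N) b i ^+ 2).
Proof.
set A := \sum_(i < N) a i ^+ 2; set B := \sum_(i < N) b i ^+ 2.
set C := \sum_(i < N) a i * b i.
have A0 : 0 <= A by apply: sumr_ge0 => i _; exact: sqr_ge0.
have H : 0 <= A * (A * B - C ^+ 2).
  have -> : A * (A * B - C ^+ 2) = \sum_(i < N) (A * b i - C * a i) ^+ 2.
    under [RHS]eq_bigr => i _.
      rewrite (_ : _ ^+ 2 = A ^+ 2 * b i ^+ 2 + (- (2 * A * C)) * (a i * b i)
        + C ^+ 2 * a i ^+ 2); last by ring.
      over.
    rewrite !big_split/= -!mulr_sumr -/A -/B -/C; ring.
  by apply: sumr_ge0 => i _; exact: sqr_ge0.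
move: A0; rewrite le_eqVlt => /predU1P[A0|A0]; last by rewrite -subr_ge0 -(pmulr_rge0 _ A0).
have a0 i : a i = 0.
  have /eqP := esym A0; rewrite psumr_eq0 => [/allP/(_ i (mem_index_enum _))|j _].
    by rewrite /= sqrf_eq0 => /eqP.
  exact: sqr_ge0.
rewrite -A0 mul0r (_ : C = 0) ?expr0n//.
by rewrite /C big1// => i _; rewrite a0 mul0r.
Qed.

Lemma sqrt_sum_triangle N (a b : 'I_N -> R) :
  Num.sqrt (\sum_(i < N) (a i + b i) ^+ 2) <=
  Num.sqrt (\sum_(i < N) a i ^+ 2) + Num.sqrt (\sum_(i < N) b i ^+ 2).
Proof.
set A := \sum_(i < N) a i ^+ 2; set B := \sum_(i < N) b i ^+ 2.
have A0 : 0 <= A by apply: sumr_ge0 => i _; exact: sqr_ge0.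
have B0 : 0 <= B by apply: sumr_ge0 => i _; exact: sqr_ge0.
have S0 : 0 <= Num.sqrt A + Num.sqrt B by rewrite addr_ge0 ?sqrtr_ge0.
rewrite -(ger0_norm S0) -sqrtr_sqr ler_wsqrtr//.
have -> : \sum_(i < N) (a i + b i) ^+ 2 = A + 2 * (\sum_(i < N) a i * b i) + B.
  rewrite /A /B mulr_sumr -!big_split/=; apply: eq_bigr => i _; ring.
have -> : (Num.sqrt A + Num.sqrt B) ^+ 2 = A + 2 * (Num.sqrt A * Num.sqrt B) + B.
  rewrite sqrrD !sqr_sqrtr//; ring.
rewrite lerD2r lerD2l ler_pM2l//.
apply: (le_trans (ler_norm _)); rewrite -sqrtr_sqr -sqrtrM// ler_wsqrtr//.
exact: cauchy_schwarz_sum.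
Qed.

Lemma edist_triangle N (x y z : N.-tuple R) : edist x z <= edist x y + edist y z.
Proof.
rewrite /edist; apply: le_trans (sqrt_sum_triangle _ _).
rewrite ler_wsqrtr//; apply: ler_sum => i _.
by rewrite (_ : tnth x i - tnth z i = tnth x i - tnth y i + (tnth y i - tnth z i))//; ring.
Qed.

Lemma enorm_edist N (x : N.-tuple R) : enorm x = edist x [tuple of nseq N 0].
Proof.
rewrite /enorm /edist; congr Num.sqrt; apply: eq_bigr => i _.
by rewrite [tnth [tuple of _] i](_ : _ = 0) ?subr0// (tnth_nth 0)/= nth_nseq if_same.
Qed.

Lemma enorm_le_edist N (x y : N.-tuple R) : enorm x <= enorm y + edist x y.
Proof. by rewrite !enorm_edist addrC; exact: edist_triangle. Qed.

Lemma eball0E N (r : R) : eball0 N r = eball [tuple of nseq N 0] r.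
Proof. by apply/funext => x; rewrite /eball0 /eball/= enorm_edist. Qed.

Lemma measurable_eball N (x : N.-tuple R) r : measurable (eball x r).
Proof. by apply: measurable_set_ltr => //; exact: measurable_edist. Qed.

Lemma measurable_eball0 N r : measurable (@eball0 R N r).
Proof. by rewrite eball0E; exact: measurable_eball. Qed.

(** Its volume factors over the coordinates of the iterated integral and is known exactly. Cubes
    outside and inside a ball give all the volume bounds that are used, so the volume of the unit
    ball never enters. *)
Definition ecube N (x : N.-tuple R) (r : R) : set (N.-tuple R) :=
  [set y | forall i, `|tnth x i - tnth y i| < r].

Lemma measurable_ecube N (x : N.-tuple R) r : measurable (ecube x r).
Proof.
rewrite (_ : ecube x r = \bigcap_(i in [set: 'I_N]) [set y | `|tnth x i - tnth y i| < r]).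
  apply: fin_bigcap_measurable => // i _; apply: measurable_set_ltr => //.
  apply: measurableT_comp => //; apply: measurable_funB => //.
  exact: measurable_tnth_comp.
by apply/seteqP; split => y //= h i => [_|]; exact: h.
Qed.

Lemma lebN_ecube N (x : N.-tuple R) (r : R) : 0 <= r ->
  lebN (ecube x r) = ((2 * r) ^+ N)%:E.
Proof.
move=> r0; rewrite /lebN; elim: N x => [|N IH] x /=.
  by rewrite expr0 indicE mem_set//; case.
transitivity (\int[@lebesgue_measure R]_t (((2 * r) ^+ N)%:E * (\1_(ball (thead x) r) t)%:E))%E.
  apply: eq_integral => t _; rewrite -(IH [tuple of behead x]) muleC -iintZ//; last first.
    by apply/measurable_EFinP; apply: measurable_indic; exact: measurable_ecube.
  congr iint; apply/funext => y; rewrite -EFinM; congr EFin.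
  rewrite !indicE -natrM mulnb; congr (nat_of_bool _)%:R.
  apply/idP/andP => [/set_mem h|[/set_mem h1 /set_mem h2]].
    split; apply/mem_set.
      by have := h ord0; rewrite tnth0 /ball/= -/(thead x).
    by move=> i; have := h (lift ord0 i); rewrite tnthS [in X in X -> _](tuple_eta x) tnthS.
  apply/mem_set => i; have [j ->|->] := unliftP ord0 i.
    by rewrite tnthS [x in tnth x](tuple_eta x) tnthS; exact: h2.
  by rewrite tnth0; exact: h1.
rewrite ge0_integralZl_EFin//; last 2 first.
- by apply/measurable_EFinP; apply: measurable_indic; exact: measurable_ball.
- by rewrite exprn_ge0// mulr_ge0.
rewrite integral_indic//; last exact: measurable_ball.
rewrite setIT; transitivity (((2 * r) ^+ N)%:E * (r *+ 2)%:E)%E.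
  by congr mule; exact: lebesgue_measure_ball.
by rewrite -EFinM exprSr mulr_natl.
Qed.

Lemma le_lebN N (A B : set (N.-tuple R)) : A `<=` B -> (lebN A <= lebN B)%E.
Proof.
move=> AB; apply: le_iint => x; first by rewrite lee_fin.
rewrite lee_fin !indicE ler_nat; have [Ax|//] := boolP (x \in A).
by rewrite mem_set//; apply: AB; exact: set_mem.
Qed.

Lemma lebN_ge0 N (A : set (N.-tuple R)) : (0 <= lebN A)%E.
Proof. by apply: iint_ge0 => x; rewrite lee_fin. Qed.

Lemma lebN_eball_le N (x : N.-tuple R) (r : R) : 0 <= r ->
  (lebN (eball x r) <= ((2 * r) ^+ N)%:E)%E.
Proof.
move=> r0; rewrite -(lebN_ecube x)//; apply: le_lebN => y /= yx i.
by apply: le_lt_trans (norm_tnth_le_edist _ _ _) _; rewrite edistC.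
Qed.

Lemma ecube_sub_eball N (x : N.-tuple R) (r e : R) : 0 <= r -> N%:R * r < e ->
  ecube x r `<=` eball x e.
Proof.
move=> r0 re y yx; apply: le_lt_trans re; rewrite edistC; apply: edist_le_max => // i.
exact/ltW/yx.
Qed.

End EuclideanGeometry.

(** * Real powers, geometric series and the integral of a truncated singular kernel *)

Section KernelIntegral.
Context {R : realType}.

Lemma powR_exprn (x a : R) j : 0 <= x -> (x ^+ j) `^ a = (x `^ a) ^+ j.
Proof.
by move=> x0; rewrite -powR_mulrn// -powRrM mulrC powRrM powR_mulrn ?powR_ge0.
Qed.

Lemma powR_addr (x a b : R) : 0 < x -> x `^ (a + b) = x `^ a * x `^ b.
Proof. by move=> x0; rewrite powRD// (gt_eqF x0) implybT. Qed.

Lemma one_powR (a : R) : 1 `^ a = 1 :> R.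
Proof. by rewrite powR1. Qed.

Lemma powR_lt1 (x a : R) : 0 < x < 1 -> 0 < a -> x `^ a < 1.
Proof.
move=> /andP[x0 x1] a0; rewrite -[ltRHS](one_powR a).
by apply: gt0_ltr_powR; rewrite ?nnegrE ?ler01// ltW.
Qed.

Lemma le_powR_neg (x y a : R) : 0 < x -> x <= y -> 0 <= a -> y `^ (- a) <= x `^ (- a).
Proof.
move=> x0 xy a0; rewrite !powRN lef_pV2 ?posrE ?powR_gt0//; last exact: lt_le_trans xy.
by apply: ge0_ler_powR; rewrite ?nnegrE// ?(ltW x0)// (le_trans (ltW x0)).
Qed.

Lemma le_powR_pos (x y a : R) : 0 <= x -> x <= y -> 0 <= a -> x `^ a <= y `^ a.
Proof.
by move=> x0 xy a0; apply: ge0_ler_powR; rewrite ?nnegrE// (le_trans x0).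
Qed.

Lemma norm_max0_sub_le (a b : R) : `|Num.max a 0 - Num.max b 0| <= `|a - b|.
Proof.
have h1 := ler_norm (a - b).
have h2 : - (a - b) <= `|a - b| by rewrite -normrN ler_norm.
rewrite ler_norml; apply/andP.
by have [] := leP a 0; have [] := leP b 0; split; lra.
Qed.

Lemma dyadic_bracket (t : R) : 1 <= t -> exists j, 2 ^+ j <= t < 2 ^+ j.+1.
Proof.
move=> t1; have t0 : 0 <= t by apply: le_trans t1.
have n0 : (0 < Num.truncn t)%N by rewrite truncn_gt0.
have /andP[h1 h2] := truncn_itv t0.
exists (trunc_log 2 (Num.truncn t)).
have /andP[k1 k2] := trunc_log_bounds (erefl : (1 < 2)%N) n0.
rewrite -!natrX; apply/andP; split.
  by apply: le_trans h1; rewrite ler_nat.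
by apply: lt_le_trans h2 _; rewrite ler_nat.
Qed.

Lemma nneseries_geometric (a q : R) : 0 <= q < 1 ->
  (\sum_(k <oo) (a * q ^+ k)%:E = (a / (1 - q))%:E)%E.
Proof.
move=> /andP[q0 q1]; apply/cvg_lim => //.
rewrite (_ : (fun n => _) = EFin \o series (geometric a q)); last first.
  by apply/funext => n; rewrite /= /series/= sumEFin.
apply: cvg_EFin; first by apply: nearW.
by apply: cvg_geometric_series; rewrite ger0_norm.
Qed.

(** Sums of two geometric series: ratio 2^-(p-a) for the shells inside radius [Rad], convergent as a
    < p, and ratio 2^-a for those outside, convergent as a > 0. Each shell is enlarged to a ball and
    then to a cube, hence the powers of 4. *)
Definition kernel_const (N : nat) (p a : R) : R :=
  4 ^+ N * 2^-1 `^ (- (N%:R + a)) / (1 - 2^-1 `^ (p - a)) + 4 ^+ N / (1 - 2 `^ (- a)).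

Lemma kernel_const_ge0 N (p a : R) : 0 < a -> a < p -> 0 <= kernel_const N p a.
Proof.
move=> a0 ap; apply: addr_ge0; apply: divr_ge0; rewrite ?mulr_ge0 ?exprn_ge0 ?powR_ge0//.
  by rewrite subr_ge0 ltW// powR_lt1// ?subr_gt0// invr_gt0 ltr0n invf_lt1// ltr1n.
rewrite subr_ge0 powRN -powR_inv1// -powRrM mulrC powRrM powR_inv1//.
by rewrite ltW// powR_lt1// invr_gt0 ltr0n invf_lt1// ltr1n.
Qed.

(** Majorant of the Gagliardo integrand of any function with Lipschitz constant 1 / [Rad] and
    oscillation at most 1. *)
Definition trunc_kernel N (p a Rad : R) (x y : N.-tuple R) : R :=
  Num.min (edist x y / Rad) 1 `^ p * edist x y `^ (- (N%:R + a)).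

Lemma trunc_kernel_ge0 N (p a Rad : R) (x y : N.-tuple R) : 0 <= trunc_kernel p a Rad x y.
Proof. by rewrite mulr_ge0// powR_ge0. Qed.

Lemma trunc_kernelC N (p a Rad : R) (x y : N.-tuple R) :
  trunc_kernel p a Rad x y = trunc_kernel p a Rad y x.
Proof. by rewrite /trunc_kernel edistC. Qed.

Lemma measurable_trunc_kernel d (T : measurableType d) N (p a Rad : R)
    (h k : T -> N.-tuple R) :
  measurable_fun setT h -> measurable_fun setT k ->
  measurable_fun setT (fun z => trunc_kernel p a Rad (h z) (k z)).
Proof.
move=> mh mk; have me := measurable_edist mh mk.
apply: measurable_funM; apply: measurable_powR_comp => //.
apply: measurable_minr => //; apply: measurable_funM => //.
Qed.

(* Dyadic shells around x, with radii Rad 2^-j and Rad 2^j. *)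
Lemma trunc_kernel_integral N (p a Rad : R) (x : N.-tuple R) :
  0 < a -> a < p -> 0 < Rad ->
  (iint (fun y => (trunc_kernel p a Rad x y)%:E) <=
   (kernel_const N p a * Rad `^ (- a))%:E)%E.
Proof.
move=> a0 ap R0; have p0 : 0 < p by apply: lt_trans ap.
have Na0 : 0 < N%:R + a by rewrite ltr_wpDl.
pose h : R := 2^-1.
have h0 : 0 < h by rewrite invr_gt0 ltr0n.
have h1 : h < 1 by rewrite invf_lt1// ltr1n.
pose E j := Rad * h ^+ j; pose D j := Rad * 2 ^+ j.
have E0 j : 0 < E j by rewrite mulr_gt0// exprn_gt0.
have D0 j : 0 < D j by rewrite mulr_gt0// exprn_gt0.
(* [A j] bounds the kernel on the shell of distances from E_j / 2 to E_j, and [B j] on the one from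
   D_j to 2 D_j. *)
pose A j := Rad `^ (- p) * E j `^ p * (E j * h) `^ (- (N%:R + a)).
pose B j := D j `^ (- (N%:R + a)).
have A0 j : 0 <= A j by rewrite !mulr_ge0 ?powR_ge0.
have B0 j : 0 <= B j by rewrite powR_ge0.
pose f j y : \bar R := ((A j)%:E * (\1_(eball x (2 * E j)) y)%:E
  + (B j)%:E * (\1_(eball x (2 * D j)) y)%:E)%E.
have mi (r : R) : measurable_fun setT (fun y => (\1_(eball x r) y)%:E : \bar R).
  by apply/measurable_EFinP; apply: measurable_indic; exact: measurable_eball.
have i0 (r : R) y : (0 <= (\1_(eball x r) y)%:E :> \bar R)%E by rewrite lee_fin.
have mf j : measurable_fun setT (f j).
  apply: emeasurable_funD; apply: emeasurable_funM => //.
have f0 j y : (0 <= f j y)%E.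
  by apply: adde_ge0; apply: mule_ge0; rewrite lee_fin.
apply: (@le_trans _ _ (iint (fun y => \sum_(j <oo) f j y)%E)).
  apply: le_iint => y; first by rewrite lee_fin trunc_kernel_ge0.
  suff [j Hj] : exists j, ((trunc_kernel p a Rad x y)%:E <= f j y)%E.
    apply: (le_trans Hj).
    apply: (@le_trans _ _ (\sum_(0 <= k < j.+1) f k y)%E).
      by rewrite big_nat_recr//= leeDr// sume_ge0.
    exact: nneseries_lim_ge.
  have := edist_ge0 x y; rewrite le_eqVlt => /predU1P[e0|].
    (* A negative power of 0 is 0 by convention, so the kernel vanishes on the diagonal. *)
    exists 0; rewrite /trunc_kernel -e0 powR0 ?mulr0//.
    by rewrite oppr_eq0 gt_eqF.
  set e := edist x y => e0.
  have [Re|eR] := leP Rad e.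
    have [j /andP[j1 j2]] : exists j, 2 ^+ j <= e / Rad < 2 ^+ j.+1.
      by apply: dyadic_bracket; rewrite ler_pdivlMr// mul1r.
    move: j1 j2; rewrite ler_pdivlMr// ltr_pdivrMr// => j1 j2.
    exists j; apply: (@le_trans _ _ (B j)%:E); last first.
      rewrite /f [X in (_ + _ * X)%E](_ : _ = 1%E) ?mule1 ?leeDr ?mule_ge0 ?lee_fin//.
      rewrite indicE mem_set// /eball/= edistC -/e; apply: (lt_le_trans j2).
      by rewrite exprS /D -mulrA (mulrC Rad).
    rewrite lee_fin /trunc_kernel -/e.
    apply: (@le_trans _ _ (1 * e `^ (- (N%:R + a)))).
      rewrite ler_wpM2r ?powR_ge0// -[leRHS](one_powR p) le_powR_pos ?ge_min ?lexx ?orbT ?ltW//.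
      by rewrite lt_min ltr01 divr_gt0.
    rewrite mul1r; apply: le_powR_neg; [exact: D0|by rewrite /D mulrC|exact: ltW].
  have [j /andP[j1 j2]] : exists j, 2 ^+ j <= Rad / e < 2 ^+ j.+1.
    by apply: dyadic_bracket; rewrite ler_pdivlMr// mul1r ltW.
  have eE : e <= E j.
    by move: j1; rewrite ler_pdivlMr// /E exprVn ler_pdivlMr ?exprn_gt0// mulrC.
  have Ee : E j * h <= e.
    move: j2; rewrite ltr_pdivrMr// /E -mulrA -exprSr exprVn => j2.
    by rewrite ler_pdivrMr ?exprn_gt0// mulrC ltW.
  exists j; apply: (@le_trans _ _ (A j)%:E); last first.
    rewrite /f [X in (_ * X + _)%E](_ : _ = 1%E) ?mule1 ?leeDl ?mule_ge0 ?lee_fin//.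
    rewrite indicE mem_set// /eball/= edistC -/e; apply: (le_lt_trans eE).
    by rewrite ltr_pMl// ltr1n.
  rewrite lee_fin /trunc_kernel -/e /A; apply: ler_pM; rewrite ?powR_ge0//.
    rewrite -[- p]mulN1r powRrM powR_inv1 ?(ltW R0)// -powRM ?invr_ge0 ?(ltW R0) ?(ltW (E0 _))//.
    apply: le_powR_pos; [by rewrite le_min ler01 divr_ge0// ltW| |exact: ltW].
    by rewrite ge_min mulrC ler_wpM2l// invr_ge0 ltW.
  by apply: le_powR_neg => //; [exact: mulr_gt0|exact: ltW].
rewrite iint_nneseries//.
pose q1 := h `^ (p - a); pose q2 : R := 2 `^ (- a).
pose c1 := 4 ^+ N * h `^ (- (N%:R + a)) * Rad `^ (- a).
pose c2 := 4 ^+ N * Rad `^ (- a).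
have H j : (iint (f j) <= (c1 * q1 ^+ j)%:E + (c2 * q2 ^+ j)%:E)%E.
  rewrite iintD//; last 4 first.
  - by apply: emeasurable_funM.
  - by apply: emeasurable_funM.
  - by move=> y; apply: mule_ge0; rewrite lee_fin.
  - by move=> y; apply: mule_ge0; rewrite lee_fin.
  rewrite !iintZ//; apply: leeD.
    apply: (@le_trans _ _ ((A j)%:E * ((2 * (2 * E j)) ^+ N)%:E)%E).
      by apply: lee_wpmul2l; rewrite ?lee_fin//; apply: lebN_eball_le; rewrite mulr_ge0 ?ltW.
    rewrite -EFinM lee_fin /A le_eqVlt; apply/orP; left; apply/eqP.
    rewrite mulrA (_ : 2 * 2 = 4 :> R); last by rewrite -natrM.
    rewrite exprMn -(powR_mulrn N (ltW (E0 j))) [(E j * h) `^ _]powRM ?ltW//.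
    transitivity (4 ^+ N * h `^ (- (N%:R + a)) * (Rad `^ (- p) * (E j `^ p * E j `^ (- (N%:R + a)) * E j `^ N%:R))).
      by ring.
    rewrite -!powR_addr// (_ : p - (N%:R + a) + N%:R = p - a); last by ring.
    rewrite /E powRM ?exprn_ge0 ?ltW// powR_exprn ?ltW// [Rad `^ (- p) * _]mulrA -powR_addr//.
    rewrite (_ : - p + (p - a) = - a); last by ring.
    by rewrite /c1 /q1; ring.
  apply: (@le_trans _ _ ((B j)%:E * ((2 * (2 * D j)) ^+ N)%:E)%E).
    by apply: lee_wpmul2l; rewrite ?lee_fin//; apply: lebN_eball_le; rewrite mulr_ge0 ?ltW.
  rewrite -EFinM lee_fin /B le_eqVlt; apply/orP; left; apply/eqP.
  rewrite mulrA (_ : 2 * 2 = 4 :> R); last by rewrite -natrM.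
  rewrite exprMn -(powR_mulrn N (ltW (D0 j))) mulrCA -powR_addr//.
  rewrite (_ : - (N%:R + a) + N%:R = - a); last by ring.
  by rewrite /D powRM ?exprn_ge0 ?ltW// powR_exprn// /c2 /q2 mulrA.
apply: (@le_trans _ _ (\sum_(j <oo) ((c1 * q1 ^+ j)%:E + (c2 * q2 ^+ j)%:E))%E).
  by apply: lee_nneseries => [j *|j *]; [exact: iint_ge0 (f0 j)|exact: H].
have q2E : q2 = h `^ a.
  by rewrite /q2 -mulN1r powRrM powR_inv1.
rewrite nneseriesD; last 2 first.
- by move=> j _; rewrite lee_fin !mulr_ge0 ?exprn_ge0 ?powR_ge0.
- by move=> j _; rewrite lee_fin !mulr_ge0 ?exprn_ge0 ?powR_ge0.
rewrite !nneseries_geometric; last 2 first.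
- by rewrite q2E powR_ge0 powR_lt1// h0.
- by rewrite powR_ge0 powR_lt1// ?h0 ?subr_gt0.
rewrite -EFinD lee_fin le_eqVlt; apply/orP; left; apply/eqP.
by rewrite /kernel_const /c1 /c2 /q1 /q2; ring.
Qed.

End KernelIntegral.

(** * Pointwise inequalities for the odd power of exponent p - 1 *)

Section PointwiseInequalities.
Context {R : realType}.
Variable p : R.
Hypothesis p1 : 1 < p.

Let q0 : 0 < p - 1. Proof. by rewrite subr_gt0. Qed.

Lemma spow_ge0E (a : R) : 0 <= a -> spow a (p - 1) = a `^ (p - 1).
Proof. by move=> a0; rewrite /spow ger0_norm// mulrC mulr_powRB1. Qed.

Lemma spow_le0E (a : R) : a <= 0 -> spow a (p - 1) = - (- a) `^ (p - 1).
Proof.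
move=> a0; rewrite /spow ler0_norm// -{2}[a]opprK mulrN mulrC mulr_powRB1//.
by rewrite oppr_ge0.
Qed.

Lemma spow_homo (a b : R) : a <= b -> spow a (p - 1) <= spow b (p - 1).
Proof.
move=> ab; have [a0|/ltW a0] := leP 0 a.
  by rewrite !spow_ge0E ?(le_trans a0)// le_powR_pos// ltW.
have [b0|/ltW b0] := leP 0 b.
  by rewrite spow_le0E// spow_ge0E// (@le_trans _ _ 0) ?powR_ge0// oppr_le0 powR_ge0.
by rewrite !spow_le0E// lerN2 le_powR_pos ?lerN2 ?oppr_ge0// ltW.
Qed.

Lemma norm_spow (a : R) : `|spow a (p - 1)| = `|a| `^ (p - 1).
Proof. by rewrite /spow normrM ger0_norm ?powR_ge0// mulrC mulr_powRB1. Qed.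

Lemma spowN (a : R) : spow (- a) (p - 1) = - spow a (p - 1).
Proof. by rewrite /spow normrN mulrN. Qed.

Lemma powR_mulr_pred (a : R) : 0 <= a -> a `^ (p - 1) * a = a `^ p.
Proof. by move=> a0; rewrite mulrC mulr_powRB1// (lt_trans _ p1). Qed.

Definition energy_coef : R := 2^-1 `^ (p - 1).
Definition energy_const : R := 2 * 3 `^ (p - 1) + energy_coef * 2 `^ p.

Lemma energy_coef_gt0 : 0 < energy_coef.
Proof. by rewrite powR_gt0// invr_gt0. Qed.

Lemma energy_const_ge0 : 0 <= energy_const.
Proof. by rewrite addr_ge0 ?mulr_ge0 ?powR_ge0// ltW// energy_coef_gt0. Qed.

(** Take a >= 0. If a >= 2 |b|, then b - a <= -a / 2, and the first term is at most -2^(1-p) a^p,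
    which absorbs the second; this fixes [energy_coef]. If a < 2 |b|, then |b - a| <= 3 |b|, and
    both terms are bounded separately, which gives the two summands of [energy_const]. *)
Lemma spow_sub_mul_le (a b : R) :
  spow (b - a) (p - 1) * a + energy_coef * `|a| `^ p <= energy_const * `|b| `^ p.
Proof.
wlog a0 : a b / 0 <= a => [H|].
  have [|/ltW a0] := leP 0 a; first exact: H.
  have := H (- a) (- b); rewrite oppr_ge0 !normrN => /(_ a0).
  have -> : - b - - a = - (b - a) by ring.
  by rewrite spowN mulrNN.
rewrite (ger0_norm a0).
have [ab|ba] := leP (2 * `|b|) a.
  have bn : b <= a / 2.
    by rewrite ler_pdivlMr// (le_trans _ ab)// mulrC ler_wpM2l// ler_norm.
  apply: (@le_trans _ _ 0); last by rewrite mulr_ge0 ?powR_ge0 ?energy_const_ge0.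
  have ba0 : b - a <= 0 by lra.
  rewrite spow_le0E// mulNr -powR_mulr_pred// mulrA addrC -mulrBl.
  rewrite mulr_le0_ge0// subr_le0 /energy_coef -powRM ?invr_ge0//.
  apply: le_powR_pos; rewrite ?mulr_ge0 ?invr_ge0// ?(ltW q0)//; lra.
have b0 : 0 <= `|b| by [].
rewrite /energy_const mulrDl lerD//.
  apply: (le_trans (ler_norm _)); rewrite normrM norm_spow (ger0_norm a0).
  apply: (@le_trans _ _ ((3 * `|b|) `^ (p - 1) * (2 * `|b|))).
    apply: ler_pM => //; rewrite ?powR_ge0// ?(ltW ba)//.
    apply: le_powR_pos; rewrite ?(ltW q0)//.
    apply: (le_trans (ler_normB _ _)); rewrite (ger0_norm a0); lra.
  by rewrite powRM// -(powR_mulr_pred b0) le_eqVlt; apply/orP; left; apply/eqP; ring.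
rewrite -mulrA ler_wpM2l// ?(ltW energy_coef_gt0)// -powRM//.
by rewrite le_powR_pos// ltW// (lt_trans _ p1).
Qed.

(** Exchanging the points allows a >= 0. If ux < vx, the truncation at y can only lower a, so ux -
    uy <= (vx - vy) - a, and monotonicity reduces to [spow_sub_mul_le] with b = vx - vy. If ux >=
    vx, both truncated differences are 0 and so is a. *)
Lemma caccioppoli_pointwise (ux uy vx vy a : R) :
  a = Num.max (vx - ux) 0 - Num.max (vy - uy) 0 ->
  spow (ux - uy) (p - 1) * a + energy_coef * `|a| `^ p <=
  energy_const * `|vx - vy| `^ p * ((ux < vx)%R%:R + (uy < vy)%R%:R).
Proof.
wlog yx : ux uy vx vy a / vy - uy <= vx - ux => [H aE|aE].
  have [|/ltW h] := leP (vy - uy) (vx - ux); first by move=> h; exact: H.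
  have := H uy ux vy vx (- a) h; rewrite aE opprB => /(_ erefl).
  have -> : uy - ux = - (ux - uy) by ring.
  rewrite spowN (distrC vy) (addrC (uy < vy)%R%:R).
  by rewrite (_ : Num.max (vy - uy) 0 - _ = - (Num.max (vx - ux) 0 - Num.max (vy - uy) 0)) ?mulrNN ?normrN// opprB.
have a0 : 0 <= a by rewrite aE subr_ge0 ge_max le_max yx/= le_max lexx orbT.
have B0 : 0 <= energy_const * `|vx - vy| `^ p by rewrite mulr_ge0 ?powR_ge0 ?energy_const_ge0.
have [uvx|vux] := ltP ux vx; last first.
  have a00 : a = 0.
    rewrite aE; have -> : Num.max (vx - ux) 0 = 0 by apply/max_idPr; rewrite subr_le0.
    by have -> : Num.max (vy - uy) 0 = 0; [apply/max_idPr; lra|rewrite subrr].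
  have pn0 : p != 0 by rewrite gt_eqF// (lt_trans _ p1).
  by rewrite a00 mulr0 normr0 (powR0 pn0) mulr0 addr0; apply: mulr_ge0.
apply: (@le_trans _ _ (energy_const * `|vx - vy| `^ p)); last first.
  by rewrite -[leLHS]mulr1 ler_wpM2l// lerDl.
apply: le_trans (spow_sub_mul_le a (vx - vy)).
rewrite lerD2r ler_wpM2r// spow_homo// aE.
have -> : Num.max (vx - ux) 0 = vx - ux by apply/max_idPl; lra.
have : vy - uy <= Num.max (vy - uy) 0 by rewrite le_max lexx.
lra.
Qed.

(** If uy >= 2 M, then uy - ux >= uy / 2 and the left side is nonpositive. Otherwise each of the two
    powers is at most M^(p-1). This yields the good term of the annulus. *)
Lemma tail_pointwise (ux uy vx M : R) : 0 <= ux -> 0 <= uy -> ux <= vx -> vx <= M ->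
  spow (ux - uy) (p - 1) * (vx - ux) + (uy / 2) `^ (p - 1) * (vx - ux) <=
  2 * M `^ (p - 1) * (vx - ux).
Proof.
move=> ux0 uy0 uvx vM; rewrite -mulrDl ler_wpM2r ?subr_ge0//.
have M0 : 0 <= M by lra.
have [h|h] := leP (2 * M) uy.
  apply: (@le_trans _ _ 0); last by rewrite mulr_ge0 ?powR_ge0.
  rewrite spow_le0E; last by lra.
  by rewrite addrC subr_le0; apply: le_powR_pos; rewrite ?(ltW q0)//; lra.
rewrite mulr_natl mulr2n lerD//.
  apply: (@le_trans _ _ (spow M (p - 1))); last by rewrite spow_ge0E.
  by apply: spow_homo; lra.
apply: le_powR_pos; last exact: ltW.
  by rewrite divr_ge0.
by rewrite ler_pdivrMr// mulrC ltW.
Qed.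

End PointwiseInequalities.

(** * Double integrals of nonnegative functions and absorption in the weak inequality *)

Section DoubleIntegral.
Context {R : realType} {N : nat}.
Local Open Scope ereal_scope.
Implicit Types f g : N.-tuple R -> N.-tuple R -> \bar R.

Definition iint2 f := iint (fun x => iint (f x)).

Definition measurable2 d (T : measurableType d) (f : N.-tuple R -> N.-tuple R -> T) :=
  measurable_fun setT (fun z : N.-tuple R * N.-tuple R => f z.1 z.2).

Lemma measurable2_section d (T : measurableType d) (f : N.-tuple R -> N.-tuple R -> T) x :
  measurable2 f -> measurable_fun setT (f x).
Proof.
move=> mf; apply: (measurableT_comp mf (g := fun y => (x, y))).
exact: measurable_fun_pair.
Qed.

Lemma measurable2_iint f : measurable2 f -> (forall x y, 0 <= f x y) ->
  measurable_fun setT (fun x => iint (f x)).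
Proof. exact: measurable_iint. Qed.

Lemma iint2_ge0 f : (forall x y, 0 <= f x y) -> 0 <= iint2 f.
Proof. by move=> f0; do 2 (apply: iint_ge0 => ?). Qed.

Lemma le_iint2 f g :
  (forall x y, 0 <= f x y) -> (forall x y, f x y <= g x y) -> iint2 f <= iint2 g.
Proof.
by move=> f0 fg; apply: le_iint => x; [exact: iint_ge0|exact: le_iint].
Qed.

Lemma iint2D f g : measurable2 f -> measurable2 g ->
  (forall x y, 0 <= f x y) -> (forall x y, 0 <= g x y) ->
  iint2 (fun x y => f x y + g x y) = iint2 f + iint2 g.
Proof.
move=> mf mg f0 g0; rewrite /iint2 -iintD; try exact: measurable2_iint; try by move=> x; exact: iint_ge0.
by congr iint; apply/funext => x; rewrite iintD//; exact: measurable2_section.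
Qed.

Lemma iint2Z (k : R) f : measurable2 f -> (forall x y, 0 <= f x y) -> (0 <= k)%R ->
  iint2 (fun x y => k%:E * f x y) = k%:E * iint2 f.
Proof.
move=> mf f0 k0; rewrite /iint2 -iintZ//; try exact: measurable2_iint; try by move=> x; exact: iint_ge0.
by congr iint; apply/funext => x; rewrite iintZ//; exact: measurable2_section.
Qed.

Lemma iint2C f : measurable2 f -> (forall x y, 0 <= f x y) ->
  iint2 (fun x y => f y x) = iint2 f.
Proof. by move=> mf f0; rewrite [RHS]iint_exchange. Qed.

Lemma iint2_prod (g h : N.-tuple R -> R) :
  measurable_fun setT g -> measurable_fun setT h ->
  (forall x, 0 <= g x)%R -> (forall x, 0 <= h x)%R ->
  iint2 (fun x y => (g x * h y)%:E) = iint (fun x => (g x)%:E * iint (fun y => (h y)%:E)).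
Proof.
move=> mg mh g0 h0; congr iint; apply/funext => x.
by rewrite -iintZ//; exact/measurable_EFinP.
Qed.

(* If [dintN F] were [+oo - +oo = -oo] the hypothesis would fail, so both parts are finite. *)
Lemma dintN_absorb (k : R) (F P Q : N.-tuple R -> N.-tuple R -> R) :
  measurable2 F -> measurable2 P -> measurable2 Q ->
  (forall x y, 0 <= P x y)%R -> (forall x y, 0 <= Q x y)%R ->
  (forall x y, F x y + P x y <= Q x y)%R ->
  iint2 (fun x y => (Q x y)%:E) < +oo ->
  - k%:E <= dintN F ->
  iint2 (fun x y => (P x y)%:E) <= iint2 (fun x y => (Q x y)%:E) + k%:E.
Proof.
move=> mF mP mQ P0 Q0 FPQ Qoo.
pose G x y := Num.max (F x y) 0%R; pose H x y := Num.max (- F x y)%R 0%R.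
have mG : measurable2 G by apply: measurable_maxr.
have mH : measurable2 H by apply: measurable_maxr => //; exact: measurable_funN.
have G0 x y : (0 <= G x y)%R by rewrite le_max lexx orbT.
have H0 x y : (0 <= H x y)%R by rewrite le_max lexx orbT.
have GQ x y : (G x y <= Q x y)%R.
  by rewrite ge_max Q0 andbT; have := FPQ x y; have := P0 x y; lra.
have E (f : N.-tuple R -> N.-tuple R -> R) : measurable2 f -> measurable2 (fun x y => (f x y)%:E).
  by move=> mf; apply/measurable_EFinP.
have iGQ : iint2 (fun x y => (G x y)%:E) <= iint2 (fun x y => (Q x y)%:E).
  by apply: le_iint2 => x y; rewrite lee_fin.
have iG0 : 0 <= iint2 (fun x y => (G x y)%:E) by apply: iint2_ge0 => x y; rewrite lee_fin.
have iH0 : 0 <= iint2 (fun x y => (H x y)%:E) by apply: iint2_ge0 => x y; rewrite lee_fin.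
have iP0 : 0 <= iint2 (fun x y => (P x y)%:E) by apply: iint2_ge0 => x y; rewrite lee_fin.
have iQ0 : 0 <= iint2 (fun x y => (Q x y)%:E) by apply: iint2_ge0 => x y; rewrite lee_fin.
(* The pointwise bound is integrated in the form F^+ + P <= Q + F^-, which contains no subtraction,
   because the integral of F^- is not yet known to be finite. *)
have S : iint2 (fun x y => (G x y)%:E) + iint2 (fun x y => (P x y)%:E) <=
         iint2 (fun x y => (Q x y)%:E) + iint2 (fun x y => (H x y)%:E).
  rewrite -!iint2D//; try exact: E; try by move=> x y; rewrite lee_fin.
  apply: le_iint2 => x y; first by rewrite lee_fin addr_ge0.
  rewrite lee_fin; have := FPQ x y; rewrite /G /H.
  by have [] := leP (F x y) 0%R; have [] := leP (- F x y)%R 0%R; lra.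
rewrite /dintN -/(iint2 (fun x y => (G x y)%:E)) -/(iint2 (fun x y => (H x y)%:E)).
move: S iGQ iG0 iH0 iP0 iQ0 Qoo.
case: (iint2 (fun x y => (G x y)%:E)) => [g| |];
case: (iint2 (fun x y => (Q x y)%:E)) => [q| |];
case: (iint2 (fun x y => (H x y)%:E)) => [h| |];
case: (iint2 (fun x y => (P x y)%:E)) => [l| |] //.
rewrite -!EFinD -EFinN !lee_fin; lra.
Qed.

End DoubleIntegral.

(** * Measurability in pairs of points and the kernel integrated over a set *)

Section TestFunction.
Context {R : realType} {N : nat}.
Implicit Types (x y : N.-tuple R) (A : set (N.-tuple R)).

Lemma measurable_indic_fst A : measurable A -> measurable2 (fun x y => \1_A x : R).
Proof. by move=> mA; apply: measurable_indic_comp. Qed.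

Lemma measurable_indic_snd A : measurable A -> measurable2 (fun x y => \1_A y : R).
Proof. by move=> mA; apply: measurable_indic_comp. Qed.

Lemma measurable2_fst (f : N.-tuple R -> R) : measurable_fun setT f -> measurable2 (fun x y => f x).
Proof. by move=> mf; exact: (measurableT_comp mf). Qed.

Lemma measurable2_snd (f : N.-tuple R -> R) : measurable_fun setT f -> measurable2 (fun x y => f y).
Proof. by move=> mf; exact: (measurableT_comp mf). Qed.

Lemma measurable2_kernel (b : R) : measurable2 (fun x y => edist x y `^ b).
Proof. by apply: measurable_powR_comp; exact: measurable_edist. Qed.

Lemma measurable2_nonlocal_form (p b : R) (u phi : N.-tuple R -> R) :
  measurable_fun setT u -> measurable_fun setT phi ->
  measurable2 (fun x y => spow (u x - u y) (p - 1) * (phi x - phi y) / edist x y `^ b).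
Proof.
move=> mu mphi; apply: (eq_measurable_fun (fun z : N.-tuple R * N.-tuple R =>
   (`|u z.1 - u z.2| `^ (p - 1 - 1) * (u z.1 - u z.2)) * (phi z.1 - phi z.2) * edist z.1 z.2 `^ (- b))).
  by move=> z _; rewrite powRN.
have mU : measurable2 (fun x y => u x - u y).
  exact: (measurable_funB (measurable2_fst mu) (measurable2_snd mu)).
apply: measurable_funM; last exact: measurable2_kernel.
apply: measurable_funM; last exact: (measurable_funB (measurable2_fst mphi) (measurable2_snd mphi)).
apply: measurable_funM; last exact: mU.
apply: measurable_powR_comp; exact: (measurableT_comp (@normr_measurable R setT) mU).
Qed.

Lemma indic_ge0 A x : 0 <= \1_A x :> R.
Proof. by rewrite indicE. Qed.

Lemma measurable_EFin2 (f : N.-tuple R -> N.-tuple R -> R) :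
  measurable2 f -> measurable2 (fun x y => (f x y)%:E).
Proof. by move=> mf; apply/measurable_EFinP. Qed.

Lemma measurable2_trunc_kernel (p a Rad : R) : measurable2 (@trunc_kernel R N p a Rad).
Proof. exact: measurable_trunc_kernel. Qed.

(** The kernel is symmetric, so both indicators contribute equally, and its integral in one variable
    is bounded uniformly in the other. *)
Lemma iint2_trunc_kernel (p a Rad : R) A : 0 < a -> a < p -> 0 < Rad -> measurable A ->
  (iint2 (fun x y => (trunc_kernel p a Rad x y * (\1_A x + \1_A y))%:E) <=
   (2 * (kernel_const N p a * Rad `^ (- a)))%:E * lebN A)%E.
Proof.
move=> a0 ap R0 mA; set c := kernel_const N p a * Rad `^ (- a).
have c0 : 0 <= c by rewrite mulr_ge0 ?powR_ge0 ?kernel_const_ge0.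
pose f (x y : N.-tuple R) : \bar R := ((\1_A x)%:E * (trunc_kernel p a Rad x y)%:E)%E.
have mf : measurable2 f.
  apply: emeasurable_funM; apply/measurable_EFinP; [exact: measurable_indic_fst|exact: measurable2_trunc_kernel].
have f0 x y : (0 <= f x y)%E by rewrite mule_ge0// lee_fin ?indic_ge0 ?trunc_kernel_ge0.
have If : (iint2 f <= c%:E * lebN A)%E.
  apply: (@le_trans _ _ (iint (fun x => c%:E * (\1_A x)%:E)%E)); last first.
    rewrite iintZ//; exact/measurable_EFinP/measurable_indic.
  apply: le_iint => x; first exact: iint_ge0.
  rewrite /f iintZ ?indic_ge0//; last 2 first.
    by apply/measurable_EFinP; exact: (measurable2_section x (measurable2_trunc_kernel p a Rad)).
    by move=> y; rewrite lee_fin trunc_kernel_ge0.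
  by rewrite muleC; apply: lee_wpmul2r; rewrite ?lee_fin ?indic_ge0// trunc_kernel_integral.
rewrite (_ : (fun x y => _) = (fun x y => f x y + f y x)%E); last first.
  apply/funext => x; apply/funext => y.
  by rewrite /f (trunc_kernelC p a Rad y x) -!EFinM -EFinD mulrDr mulrC [_ * \1_A y]mulrC.
have mfC : measurable2 (fun x y => f y x).
  exact: (measurableT_comp mf (g := fun z : N.-tuple R * N.-tuple R => (z.2, z.1))
    (measurable_fun_pair measurable_snd measurable_fst)).
rewrite (iint2D mf mfC f0 (fun x y => f0 y x)) (iint2C mf f0) mulr_natl mulr2n EFinD ge0_muleDl ?lee_fin//.
exact: leeD.
Qed.

(** * Truncated cones, the test functions [undershoot] and their admissibility *)

Section Barrier.
Variables (Rad m : R).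
Hypotheses (Rad0 : 0 < Rad) (m0 : 0 < m).

(* The cone equals 2 m on |x| = Rad / 4 and vanishes on |x| = 7 Rad / 24 < Rad / 3. *)
Definition barrier (th : R) x := Num.max (48 * m * (7 / 24 - enorm x / Rad) - th * m) 0.

Variable th : R.
Hypothesis th01 : 0 <= th <= 1.

Lemma barrier_ge0 x : 0 <= barrier th x.
Proof. by rewrite le_max lexx orbT. Qed.

Lemma barrier_le x : barrier th x <= 14 * m.
Proof.
have /andP[t0 t1] := th01.
have e0 : 0 <= enorm x / Rad by rewrite divr_ge0 ?enorm_ge0// ltW.
rewrite ge_max; apply/andP; split; last by rewrite mulr_ge0// ltW.
have : 0 <= m * (enorm x / Rad) by rewrite mulr_ge0// ltW.
have : 0 <= th * m by rewrite mulr_ge0// ltW.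
nra.
Qed.

Lemma barrier_eq0 x : 7 / 24 * Rad <= enorm x -> barrier th x = 0.
Proof.
have /andP[t0 t1] := th01.
rewrite -ler_pdivlMr// => h; apply/max_idPr.
have : 0 <= m * (enorm x / Rad - 7 / 24) by rewrite mulr_ge0 ?subr_ge0// ltW.
have : 0 <= th * m by rewrite mulr_ge0// ltW.
nra.
Qed.

(** The slope of the cone is 48 m / [Rad], and its values lie between 0 and 14 m, below 48 m. One
    constant thus serves both entries of the minimum, as [trunc_kernel] requires. *)
Lemma barrier_lipschitz x y :
  `|barrier th x - barrier th y| <= 48 * m * Num.min (edist x y / Rad) 1.
Proof.
have M0 : 0 <= 48 * m by rewrite mulr_ge0// ltW.
rewrite minr_pMr// le_min; apply/andP; split; last first.
  have := barrier_le x; have := barrier_le y; have := barrier_ge0 x; have := barrier_ge0 y.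
  rewrite ler_norml mulr1; lra.
suff H x' y' : barrier th x' - barrier th y' <= 48 * m * (edist x' y' / Rad).
  by rewrite ler_norml H lerNl opprB edistC H.
have e : (enorm y' - enorm x') / Rad <= edist x' y' / Rad.
  apply: ler_wpM2r; first by rewrite invr_ge0 ltW.
  by rewrite lerBlDl edistC enorm_le_edist.
have := ler_wpM2l M0 e => {}e.
have z : 0 <= 48 * m * (edist x' y' / Rad).
  by rewrite mulr_ge0// divr_ge0 ?edist_ge0 ?ltW.
rewrite /barrier.
set X := 48 * m * (7 / 24 - enorm x' / Rad) - th * m.
set Y := 48 * m * (7 / 24 - enorm y' / Rad) - th * m.
have XY : X - Y <= 48 * m * (edist x' y' / Rad).
  by apply: le_trans e; rewrite le_eqVlt; apply/orP; left; apply/eqP; rewrite /X /Y; ring.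
by have [] := leP X 0; have [] := leP Y 0; lra.
Qed.

Lemma measurable_barrier : measurable_fun setT (barrier th).
Proof.
apply: measurable_maxr => //; apply: measurable_funB => //.
apply: measurable_funM => //; apply: measurable_funB => //.
by apply: measurable_funM => //; exact: measurable_enorm.
Qed.

(** Raising the level lowers the cone, and where the lower cone is positive neither truncation is
    active. Hence the sets A_th decrease in th, and on A_th' the undershoot of level th is at least
    (th' - th) m. *)
Lemma barrier_shift th' x : th <= th' -> 0 < barrier th' x ->
  barrier th' x + (th' - th) * m <= barrier th x.
Proof.
move=> tt; rewrite {1}/barrier lt_max ltxx orbF => h.
rewrite {1}/barrier; have -> : Num.max (48 * m * (7 / 24 - enorm x / Rad) - th' * m) 0 =
    48 * m * (7 / 24 - enorm x / Rad) - th' * m.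
  by apply/max_idPl; exact: ltW.
rewrite le_max; apply/orP; left; lra.
Qed.

Definition undershoot (u : N.-tuple R -> R) x := Num.max (barrier th x - u x) 0.
Definition undershoot_set (u : N.-tuple R -> R) := [set x | u x < barrier th x].

Variables (u : N.-tuple R -> R).
Hypotheses (mu : measurable_fun setT u) (u0 : forall x, 0 <= u x).

Lemma measurable_undershoot : measurable_fun setT (undershoot u).
Proof.
by apply: measurable_maxr => //; apply: measurable_funB => //; exact: measurable_barrier.
Qed.

Lemma measurable_undershoot_set : measurable (undershoot_set u).
Proof. by apply: measurable_set_ltr => //; exact: measurable_barrier. Qed.

Lemma undershoot_ge0 x : 0 <= undershoot u x.
Proof. by rewrite le_max lexx orbT. Qed.

Lemma undershoot_notin x : ~ undershoot_set u x -> undershoot u x = 0.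
Proof.
by rewrite /undershoot_set/= => /negP; rewrite -leNgt => h; apply/max_idPr; rewrite subr_le0.
Qed.

Lemma undershoot_in x : undershoot_set u x -> undershoot u x = barrier th x - u x.
Proof. by move=> h; apply/max_idPl; rewrite subr_ge0 ltW. Qed.

Lemma undershoot_set_sub x : undershoot_set u x -> enorm x < 7 / 24 * Rad.
Proof.
rewrite /undershoot_set/= ltNge => /negP h; rewrite ltNge; apply/negP => k.
by apply: h; rewrite barrier_eq0.
Qed.

Lemma undershoot_le x : undershoot u x <= 14 * m * \1_(undershoot_set u) x.
Proof.
rewrite indicE; have [xA|xA] := boolP (x \in undershoot_set u).
  by rewrite mulr1 (undershoot_in (set_mem xA)) lerBlDr (le_trans (barrier_le x))// lerDl.
by rewrite mulr0 undershoot_notin// => /mem_set; exact/negP.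
Qed.

Lemma lebN_undershoot_set : (lebN (undershoot_set u) <= ((2 * Rad) ^+ N)%:E)%E.
Proof.
apply: le_trans (lebN_eball_le [tuple of nseq N 0] (ltW Rad0)).
rewrite -eball0E; apply: le_lebN => x /undershoot_set_sub; rewrite /eball0/=.
have := Rad0; lra.
Qed.

Lemma intN_undershoot_le (Om : set (N.-tuple R)) :
  (intN Om (undershoot u) <= (14 * m)%:E * lebN (undershoot_set u))%E.
Proof.
rewrite /lebN -iintZ ?mulr_ge0 ?(ltW m0)//; last first.
  by apply/measurable_EFinP; apply: measurable_indic; exact: measurable_undershoot_set.
apply: le_iint => x; first by rewrite lee_fin mulr_ge0 ?indic_ge0 ?undershoot_ge0.
rewrite lee_fin; apply: le_trans (undershoot_le x).
by rewrite ler_piMl ?undershoot_ge0// indicE lern1 leq_b1.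
Qed.

Lemma powR_normD_le (p a b : R) : 0 <= p ->
  `|a + b| `^ p <= 2 `^ p * (`|a| `^ p + `|b| `^ p).
Proof.
move=> p0; wlog ab : a b / `|a| <= `|b| => [H|].
  have [|/ltW h] := leP `|a| `|b|; first exact: H.
  by rewrite addrC (addrC (`|a| `^ p)); exact: H.
apply: (@le_trans _ _ (2 `^ p * `|b| `^ p)); last first.
  by rewrite ler_wpM2l ?powR_ge0// lerDr powR_ge0.
rewrite -powRM//; apply: le_powR_pos => //.
apply: (le_trans (ler_normD _ _)); lra.
Qed.

Lemma barrier_kernel_le (p a : R) x y : 0 <= p ->
  `|barrier th x - barrier th y| `^ p * edist x y `^ (- (N%:R + a)) <=
  (48 * m) `^ p * trunc_kernel p a Rad x y.
Proof.
move=> p0; rewrite /trunc_kernel mulrA ler_wpM2r ?powR_ge0//.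
rewrite -powRM ?mulr_ge0 ?(ltW m0)//; last by rewrite le_min ler01 divr_ge0 ?edist_ge0// ltW.
exact: le_powR_pos (barrier_lipschitz x y) p0.
Qed.

(** The regularity of u is known only in U, while the test function needs finite energy over the
    whole space. If both points lie in the ball, its increment is at most that of the cone plus that
    of u. If one lies outside, the cone and the undershoot both vanish there; as u >= 0 keeps the
    undershoot between 0 and the cone, its increment is at most that of the cone alone, and u does
    not enter. *)
Lemma W0sp_undershoot (s p : R) (U : set (N.-tuple R)) : 0 < s < 1 -> 1 < p ->
  @eball0 R N (Rad / 3) `<=` U -> Wsp s p U u -> W0sp s p (eball0 N (Rad / 3)) (undershoot u).
Proof.
move=> /andP[s0 s1] p1 BU [_ [_ Wu]].
have p0 : 0 < p by apply: lt_trans p1.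
have sp0 : 0 < s * p by rewrite mulr_gt0.
have spp : s * p < p by rewrite gtr_pMl.
have R3 : 7 / 24 * Rad <= Rad / 3 by have := Rad0; lra.
set B := @eball0 R N (Rad / 3) in BU *.
have mB : measurable B by exact: measurable_eball0.
have BE x : ~ B x -> barrier th x = 0.
  by move=> /negP; rewrite -leNgt => h; apply: barrier_eq0; exact: le_trans h.
have psi0 x : ~ B x -> undershoot u x = 0.
  by move=> h; apply/max_idPr; rewrite BE// sub0r oppr_le0.
split; last first.
  rewrite /ae_in (_ : [set x | _] = set0) ?/lebN.
    by rewrite (_ : (fun x => _) = fun=> 0%E) ?iint0//; apply/funext => x; rewrite indic0.
  by apply/seteqP; split => x //= [h]; rewrite psi0.
split; first exact: measurable_undershoot.
split.
  apply: (@le_lt_trans _ _ (iint (fun x => ((14 * m) `^ p)%:E * (\1_(undershoot_set u) x)%:E)%E)).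
    apply: le_iint => x; first by rewrite lee_fin mulr_ge0 ?indic_ge0 ?powR_ge0.
    rewrite indicT mul1r -EFinM lee_fin ger0_norm ?undershoot_ge0//.
    have [h|h] := pselect (undershoot_set u x); last first.
      by rewrite undershoot_notin// powR0 ?gt_eqF// mulr_ge0 ?indic_ge0 ?powR_ge0.
    rewrite (_ : \1_(undershoot_set u) x = 1) ?mulr1; last by rewrite indicE mem_set.
    apply: le_powR_pos; rewrite ?undershoot_ge0 ?(ltW p0)//.
    by apply: le_trans (undershoot_le x) _; rewrite indicE mem_set// mulr1.
  rewrite iintZ ?powR_ge0//; last first.
    by apply/measurable_EFinP; apply: measurable_indic; exact: measurable_undershoot_set.
  by rewrite lte_mul_pinfty ?lee_fin ?powR_ge0// (le_lt_trans lebN_undershoot_set)// ltry.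
pose f x y : \bar R := ((2 `^ p)%:E * ((48 * m) `^ p * (trunc_kernel p (s * p) Rad x y * (\1_B x + \1_B y)))%:E)%E.
pose g x y : \bar R := ((2 `^ p)%:E * (\1_B x * \1_B y * (`|u x - u y| `^ p / edist x y `^ (N%:R + s * p)))%:E)%E.
have mtk : measurable2 (fun x y => trunc_kernel p (s * p) Rad x y * (\1_B x + \1_B y)).
  apply: measurable_funM; first exact: measurable2_trunc_kernel.
  apply: measurable_funD; first exact: (measurable_indic_fst mB).
  exact: (measurable_indic_snd mB).
have mg : measurable2 (fun x y => \1_B x * \1_B y * (`|u x - u y| `^ p / edist x y `^ (N%:R + s * p))).
  apply: measurable_funM.
    apply: measurable_funM; first exact: (measurable_indic_fst mB).
    exact: (measurable_indic_snd mB).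
  apply: (eq_measurable_fun (fun z : N.-tuple R * N.-tuple R =>
      `|u z.1 - u z.2| `^ p * edist z.1 z.2 `^ (- (N%:R + s * p)))).
    by move=> z _; rewrite powRN.
  apply: measurable_funM; apply: measurable_powR_comp; last exact: measurable_edist.
  apply: (measurableT_comp (@normr_measurable R setT)).
  exact: (measurable_funB (measurableT_comp mu measurable_fst) (measurableT_comp mu measurable_snd)).
have tk0 x y : 0 <= (48 * m) `^ p * (trunc_kernel p (s * p) Rad x y * (\1_B x + \1_B y)).
  by rewrite !mulr_ge0 ?powR_ge0 ?addr_ge0 ?indic_ge0 ?trunc_kernel_ge0.
have g0 x y : 0 <= \1_B x * \1_B y * (`|u x - u y| `^ p / edist x y `^ (N%:R + s * p)).
  by rewrite !mulr_ge0 ?invr_ge0 ?powR_ge0 ?indic_ge0.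
have f0' x y : (0 <= f x y)%E by rewrite mule_ge0// lee_fin ?powR_ge0.
have g0' x y : (0 <= g x y)%E by rewrite mule_ge0// lee_fin ?powR_ge0.
have mf' : measurable2 f.
  by apply: emeasurable_funM => //; apply/measurable_EFinP; apply: measurable_funM.
have mg' : measurable2 g.
  by apply: emeasurable_funM => //; apply/measurable_EFinP.
apply: (@le_lt_trans _ _ (iint2 (fun x y => f x y + g x y)%E)).
  apply: le_iint2 => x y; first by rewrite lee_fin !mulr_ge0 ?invr_ge0 ?powR_ge0 ?indic_ge0.
  rewrite !indicT !mul1r /f /g -!EFinM -EFinD lee_fin -mulrDr.
  set k := edist x y `^ (N%:R + s * p).
  have kN : k^-1 = edist x y `^ (- (N%:R + s * p)) by rewrite powRN.
  have k0 : 0 <= k^-1 by rewrite invr_ge0 powR_ge0.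
  have vk : `|barrier th x - barrier th y| `^ p / k <=
      (48 * m) `^ p * (trunc_kernel p (s * p) Rad x y * (\1_B x + \1_B y)).
    have [h|h] := pselect (B x \/ B y); last first.
      have hx : barrier th x = 0 by apply: BE => Bx; apply: h; left.
      have hy : barrier th y = 0 by apply: BE => By; apply: h; right.
      by rewrite hx hy subrr normr0 powR0 ?gt_eqF// mul0r.
    rewrite kN; apply: le_trans (barrier_kernel_le _ _ _ (ltW p0)) _.
    rewrite mulrA ler_peMr ?mulr_ge0 ?powR_ge0 ?trunc_kernel_ge0//.
    by rewrite !indicE; case: h => h; rewrite (mem_set h) ?lerDl ?lerDr.
  have T0 : 0 <= 2 `^ p * ((48 * m) `^ p * (trunc_kernel p (s * p) Rad x y * (\1_B x + \1_B y))).
    by rewrite mulr_ge0 ?powR_ge0.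
  have two1 : 1 <= 2 `^ p by rewrite -[leLHS](one_powR p); apply: le_powR_pos; rewrite ?ler1n ?(ltW p0).
  have psiv (x' y' : N.-tuple R) : ~ B y' -> `|undershoot u x' - undershoot u y'| <= `|barrier th x' - barrier th y'|.
    move=> h; rewrite (psi0 _ h) (BE _ h) !subr0 !ger0_norm ?barrier_ge0 ?undershoot_ge0//.
    by rewrite ge_max barrier_ge0 andbT lerBlDr lerDl.
  have out : `|undershoot u x - undershoot u y| <= `|barrier th x - barrier th y| ->
    `|undershoot u x - undershoot u y| `^ p / k <=
    2 `^ p * ((48 * m) `^ p * (trunc_kernel p (s * p) Rad x y * (\1_B x + \1_B y)) +
      \1_B x * \1_B y * (`|u x - u y| `^ p / k)).
    move=> h; apply: (@le_trans _ _ (`|barrier th x - barrier th y| `^ p / k)).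
      by rewrite ler_wpM2r// le_powR_pos// ltW.
    apply: (le_trans vk); rewrite [leRHS]mulrDr -[leLHS]addr0; apply: lerD.
      by rewrite ler_peMl.
    by rewrite mulr_ge0 ?powR_ge0// g0.
  have [Bx|Bx] := pselect (B x); last by apply: out; rewrite distrC (distrC (barrier th x)); exact: psiv.
  have [By|By] := pselect (B y); last by apply: out; exact: psiv.
  have h : `|undershoot u x - undershoot u y| <= `|(barrier th x - barrier th y) + (u y - u x)|.
    rewrite (_ : barrier th x - barrier th y + (u y - u x) =
      (barrier th x - u x) - (barrier th y - u y)); last by ring.
    exact: norm_max0_sub_le.
  apply: (@le_trans _ _ (2 `^ p * (`|barrier th x - barrier th y| `^ p + `|u y - u x| `^ p) / k)).
    rewrite ler_wpM2r//; apply: le_trans (powR_normD_le _ _ (ltW p0)).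
    by rewrite le_powR_pos// ltW.
  rewrite -mulrA ler_wpM2l ?powR_ge0// mulrDl lerD//.
  by rewrite !indicE (mem_set Bx) (mem_set By) !mul1r distrC.
rewrite iint2D// lte_add_pinfty//.
- rewrite /f iint2Z ?powR_ge0//; last by apply/measurable_EFinP; apply: measurable_funM.
  rewrite lte_mul_pinfty ?lee_fin ?powR_ge0//.
  rewrite (_ : (fun x y => _) = (fun x y =>
    ((48 * m) `^ p)%:E * (trunc_kernel p (s * p) Rad x y * (\1_B x + \1_B y))%:E)%E)//.
  rewrite iint2Z ?powR_ge0//; last 2 first.
  + exact: measurable_EFin2.
  + by move=> x y; rewrite lee_fin mulr_ge0 ?addr_ge0 ?indic_ge0 ?trunc_kernel_ge0.
  rewrite lte_mul_pinfty ?lee_fin ?powR_ge0//.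
  apply: (le_lt_trans (iint2_trunc_kernel sp0 spp Rad0 mB)).
  rewrite lte_mul_pinfty ?lee_fin ?mulr_ge0 ?powR_ge0 ?kernel_const_ge0//.
  have R30 : 0 <= Rad / 3 by rewrite divr_ge0// ltW.
  by rewrite /B eball0E (le_lt_trans (lebN_eball_le _ R30))// ltry.
- rewrite /g iint2Z ?powR_ge0//; last exact: measurable_EFin2.
  rewrite lte_mul_pinfty ?lee_fin ?powR_ge0//.
  apply: le_lt_trans Wu; apply: le_iint2 => x y; first by rewrite lee_fin.
  rewrite lee_fin ler_wpM2r ?mulr_ge0 ?invr_ge0 ?powR_ge0// !indicE.
  have [Bx|_] := boolP (x \in B); last by rewrite mul0r mulr_ge0.
  have [By|_] := boolP (y \in B); last by rewrite mulr0 mulr_ge0.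
  by rewrite !mem_set//; apply: BU; exact: set_mem.
Qed.

End Barrier.
End TestFunction.

(** * Energy estimates: Caccioppoli, decay between levels, and the annulus term *)

Section Energy.
Context {R : realType} {N : nat}.
Implicit Types x y : N.-tuple R.
Variables (s p : R).
Hypotheses (s01 : 0 < s < 1) (p1 : 1 < p).
Variables (Rad m K : R).
Hypotheses (Rad0 : 0 < Rad) (m0 : 0 < m) (K0 : 0 <= K) (KRm : K * Rad `^ (p * s) <= m `^ (p - 1)).
Variables (u : N.-tuple R -> R) (U : set (N.-tuple R)).
Hypotheses (mu : measurable_fun setT u) (u0 : forall x, 0 <= u x).
Hypotheses (BU : eball0 N (Rad / 3) `<=` U) (WU : Wsp s p U u).
Hypothesis superu : weak_super s p K (eball0 N (Rad / 3)) u.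

Let p0 : 0 < p. Proof. exact: lt_trans p1. Qed.
Let ps0 : 0 < p * s. Proof. by case/andP: s01 => ? _; rewrite mulr_gt0. Qed.
Let psp : p * s < p. Proof. by case/andP: s01 => _ ?; rewrite gtr_pMr. Qed.

(** The first summand is the energy of the cone. The 14 is the source term: the undershoot is at
    most 14 m, and K <= m^(p-1) Rad^(-ps) makes K times its integral at most 14 m^p Rad^(-ps)
    |A|. *)
Definition energy_bound : R :=
  2 * energy_const p * 48 `^ p * kernel_const N p (p * s) + 14.

Lemma energy_bound_gt0 : 0 < energy_bound.
Proof.
rewrite ltr_wpDl// !mulr_ge0 ?powR_ge0 ?kernel_const_ge0 ?energy_const_ge0//.
Qed.

Section Level.
Variable th : R.
Hypothesis th01 : 0 <= th <= 1.

Local Notation psi := (undershoot Rad m th u).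
Local Notation A := (undershoot_set Rad m th u).

Let mpsi : measurable_fun setT psi. Proof. exact: measurable_undershoot. Qed.
Let mA : measurable A. Proof. exact: measurable_undershoot_set. Qed.

Definition kinetic x y := spow (u x - u y) (p - 1) * (psi x - psi y) / edist x y `^ (N%:R + p * s).
Definition barrier_energy x y :=
  energy_const p * (48 * m) `^ p * (trunc_kernel p (p * s) Rad x y * (\1_A x + \1_A y)).

Lemma measurable2_kinetic : measurable2 kinetic.
Proof. exact: measurable2_nonlocal_form. Qed.

Lemma barrier_energy_ge0 x y : 0 <= barrier_energy x y.
Proof.
rewrite /barrier_energy mulr_ge0 ?(mulr_ge0 (energy_const_ge0 _)) ?powR_ge0//.
by rewrite mulr_ge0 ?trunc_kernel_ge0// addr_ge0 ?indic_ge0.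
Qed.

Lemma measurable2_barrier_energy : measurable2 barrier_energy.
Proof.
apply: measurable_funM => //; apply: measurable_funM; first exact: measurable2_trunc_kernel.
exact: (measurable_funD (measurable_indic_fst mA) (measurable_indic_snd mA)).
Qed.

Lemma lebN_level_fin : lebN A \is a fin_num.
Proof.
rewrite ge0_fin_numE ?lebN_ge0//.
by apply: (le_lt_trans (lebN_undershoot_set Rad0 m0 th01 u0)); rewrite ltry.
Qed.

Lemma iint2_barrier_energy :
  (iint2 (fun x y => (barrier_energy x y)%:E) <=
   (2 * energy_const p * 48 `^ p * kernel_const N p (p * s) * (m `^ p * Rad `^ (- (p * s))))%:E * lebN A)%E.
Proof.
rewrite (_ : (fun x y => _) = (fun x y => (energy_const p * (48 * m) `^ p)%:E *
   (trunc_kernel p (p * s) Rad x y * (\1_A x + \1_A y))%:E)%E)//.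
rewrite iint2Z; last 3 first.
- apply/measurable_EFinP; apply: measurable_funM; first exact: measurable2_trunc_kernel.
  exact: (measurable_funD (measurable_indic_fst mA) (measurable_indic_snd mA)).
- by move=> x y; rewrite lee_fin mulr_ge0 ?addr_ge0 ?indic_ge0 ?trunc_kernel_ge0.
- by rewrite mulr_ge0 ?powR_ge0 ?energy_const_ge0.
apply: (@le_trans _ _ ((energy_const p * (48 * m) `^ p)%:E *
   ((2 * (kernel_const N p (p * s) * Rad `^ (- (p * s))))%:E * lebN A))%E).
  apply: lee_wpmul2l; first by rewrite lee_fin mulr_ge0 ?powR_ge0 ?energy_const_ge0.
  exact: iint2_trunc_kernel.
rewrite muleA -EFinM powRM ?(ltW m0)// le_eqVlt; apply/orP; left; apply/eqP.
by congr (_%:E * _)%E; ring.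
Qed.

Lemma kinetic_le x y : kinetic x y + energy_coef p * (`|psi x - psi y| `^ p * edist x y `^ (- (N%:R + p * s)))
  <= barrier_energy x y.
Proof.
rewrite /kinetic -powRN mulrA -mulrDl.
apply: (@le_trans _ _ (energy_const p * `|barrier Rad m th x - barrier Rad m th y| `^ p *
    ((u x < barrier Rad m th x)%R%:R + (u y < barrier Rad m th y)%R%:R) * edist x y `^ (- (N%:R + p * s)))).
  by apply: ler_wpM2r; [exact: powR_ge0|exact: caccioppoli_pointwise].
have E z : \1_A z = (u z < barrier Rad m th z)%R%:R :> R.
  by rewrite indicE; congr (nat_of_bool _)%:R; apply/idP/idP => [/set_mem|h]//; exact: mem_set.
rewrite /barrier_energy !E mulrAC -!mulrA ler_wpM2l ?energy_const_ge0// !mulrA.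
apply: ler_wpM2r; first by rewrite addr_ge0.
have := barrier_kernel_le Rad0 m0 th01 (p * s) x y (ltW p0).
by rewrite /trunc_kernel mulrA.
Qed.

(** [P] and [Q] are left free because the equation is tested for two purposes: with [P] the energy
    and [Q] zero for the decay, and with [P] the annulus term and [Q] its bounded excess for the
    smallness of the starting set. *)
Lemma undershoot_energy (P Q : N.-tuple R -> N.-tuple R -> R) :
  measurable2 P -> measurable2 Q ->
  (forall x y, 0 <= P x y) -> (forall x y, 0 <= Q x y) ->
  (forall x y, kinetic x y + P x y <= barrier_energy x y + Q x y) ->
  (iint2 (fun x y => (Q x y)%:E) < +oo)%E ->
  (iint2 (fun x y => (P x y)%:E) <=
   (energy_bound * (m `^ p * Rad `^ (- (p * s))))%:E * lebN A + iint2 (fun x y => (Q x y)%:E))%E.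
Proof.
move=> mP mQ P0 Q0 PQ Qoo.
have Om := intN_undershoot_le Rad0 m0 th01 mu u0 (eball0 N (Rad / 3)).
set I := intN _ _ in Om.
have I0 : (0 <= I)%E.
  by apply: iint_ge0 => x; rewrite lee_fin mulr_ge0 ?indic_ge0 ?undershoot_ge0.
have Afin := lebN_level_fin.
have Ifin : I \is a fin_num.
  rewrite ge0_fin_numE//; apply: (le_lt_trans Om).
  by rewrite lte_mul_pinfty ?lee_fin ?mulr_ge0 ?(ltW m0)// ltey_eq Afin.
have mR : measurable2 (fun x y => barrier_energy x y + Q x y).
  exact: (measurable_funD measurable2_barrier_energy mQ).
have R0 x y : 0 <= barrier_energy x y + Q x y by rewrite addr_ge0 ?barrier_energy_ge0.
have IR : iint2 (fun x y => (barrier_energy x y + Q x y)%:E) =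
   (iint2 (fun x y => (barrier_energy x y)%:E) + iint2 (fun x y => (Q x y)%:E))%E.
  rewrite -iint2D//.
  - by apply/measurable_EFinP; exact: measurable2_barrier_energy.
  - exact/measurable_EFinP.
  - by move=> x y; rewrite lee_fin barrier_energy_ge0.
have be := iint2_barrier_energy.
have beoo : (iint2 (fun x y => (barrier_energy x y)%:E) < +oo)%E.
  apply: (le_lt_trans be); rewrite lte_mul_pinfty ?lee_fin//; last by rewrite ltey_eq Afin.
  by rewrite !mulr_ge0 ?powR_ge0 ?kernel_const_ge0 ?energy_const_ge0.
have main : (iint2 (fun x y => (P x y)%:E) <=
    iint2 (fun x y => (barrier_energy x y + Q x y)%:E) + (K * fine I)%:E)%E.
  apply: (@dintN_absorb _ _ _ kinetic) => //.
  - exact: measurable2_kinetic.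
  - by rewrite IR lte_add_pinfty.
  rewrite EFinM (fineK Ifin).
  apply: superu; first exact: (W0sp_undershoot Rad0 m0 th01 mu u0 s01 p1 BU WU).
  by move=> x; exact: undershoot_ge0.
apply: (le_trans main); rewrite IR addeAC leeD2r//.
have KI : ((K * fine I)%:E <= (14 * (m `^ p * Rad `^ (- (p * s))))%:E * lebN A)%E.
  move: Om; rewrite -(fineK Ifin) -(fineK Afin) -!EFinM !lee_fin => Om.
  apply: (le_trans (ler_wpM2l K0 Om)); rewrite !mulrA ler_wpM2r ?fine_ge0 ?lebN_ge0//.
  have KR : K <= m `^ (p - 1) * Rad `^ (- (p * s)).
    by rewrite powRN ler_pdivlMr// powR_gt0.
  have := ler_wpM2r (ltW m0) KR.
  rewrite -(powR_mulr_pred p1 (ltW m0)); lra.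
apply: (le_trans (leeD be KI)).
by rewrite -ge0_muleDl ?lee_fin ?mulr_ge0 ?powR_ge0 ?kernel_const_ge0 ?energy_const_ge0// -EFinD -mulrDl.
Qed.

Lemma undershoot_caccioppoli :
  (iint2 (fun x y => (energy_coef p * (`|psi x - psi y| `^ p * edist x y `^ (- (N%:R + p * s))))%:E) <=
   (energy_bound * (m `^ p * Rad `^ (- (p * s))))%:E * lebN A)%E.
Proof.
pose P x y := energy_coef p * (`|psi x - psi y| `^ p * edist x y `^ (- (N%:R + p * s))).
have mP : measurable2 P.
  apply: measurable_funM => //; apply: measurable_funM; last exact: measurable2_kernel.
  apply: measurable_powR_comp; apply: (measurableT_comp (@normr_measurable R setT)).
  exact: (measurable_funB (measurable2_fst mpsi) (measurable2_snd mpsi)).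
have P0 x y : 0 <= P x y.
  by rewrite /P; apply: mulr_ge0; [exact/ltW/energy_coef_gt0|rewrite mulr_ge0 ?powR_ge0].
have PQ x y : kinetic x y + P x y <= barrier_energy x y + 0 by rewrite addr0 kinetic_le.
have i0 : iint2 (fun _ _ : N.-tuple R => 0%:E) = 0%E :> \bar R.
  by rewrite /iint2 (_ : (fun _ => _) = fun=> 0%E) ?iint0//; apply/funext => x; rewrite iint0.
have := @undershoot_energy P (fun _ _ => 0) mP (measurable_cst _) P0 (fun _ _ => lexx _) PQ.
by rewrite i0 adde0; apply.
Qed.

(* On A_th' the undershoot is at least (th' - th) m, and it vanishes on at least half of a cube
   around each of its points. *)
Lemma undershoot_decay (th' r : R) : th <= th' -> 0 < r ->
  (2%:E * lebN A <= ((2 * r) ^+ N)%:E)%E ->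
  ((energy_coef p * (((th' - th) * m) `^ p * ((N.+1%:R * r) `^ (- (N%:R + p * s)))) * ((2 * r) ^+ N / 2))%:E
     * lebN (undershoot_set Rad m th' u) <=
   (energy_bound * (m `^ p * Rad `^ (- (p * s))))%:E * lebN A)%E.
Proof.
move=> tt r0 hA; apply: le_trans undershoot_caccioppoli.
set A' := undershoot_set Rad m th' u.
have mA' : measurable A' by exact: measurable_undershoot_set.
set k := energy_coef p * _.
have k0 : 0 <= k by rewrite !mulr_ge0 ?powR_ge0// ltW// energy_coef_gt0.
have r20 : 0 <= (2 * r) ^+ N by rewrite exprn_ge0// mulr_ge0// ltW.
have e0 : 0 < N.+1%:R * r by rewrite mulr_gt0.
have kr0 : 0 <= k * ((2 * r) ^+ N / 2) by rewrite mulr_ge0// divr_ge0.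
rewrite /lebN -iintZ//; last by apply/measurable_EFinP; exact: measurable_indic.
apply: le_iint => x; first by rewrite mule_ge0// lee_fin indic_ge0.
have [A'x|nA'x] := pselect (A' x); last first.
  rewrite indicE (_ : x \in A' = false) ?mule0; last by apply/negP => /set_mem.
  apply: iint_ge0 => y; rewrite lee_fin.
  by apply: mulr_ge0; [exact/ltW/energy_coef_gt0|rewrite mulr_ge0 ?powR_ge0].
rewrite indicE mem_set// mule1.
set e := N.+1%:R * r.
have mD : measurable (eball x e `\` A) by apply: measurableD => //; exact: measurable_eball.
apply: (@le_trans _ _ (iint (fun y => k%:E * (\1_(eball x e `\` A) y)%:E)%E)).
  rewrite iintZ//; last by apply/measurable_EFinP; exact: measurable_indic.
  rewrite EFinM lee_wpmul2l// -/(lebN _).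
  (* The cube of half-side r lies in the ball of radius (N + 1) r. The total volume of A is at most
     half that of the cube, so the complement of A fills at least (2 r)^N / 2 of the ball. *)
  have : (lebN (ecube x r) <= lebN (eball x e `\` A) + lebN A)%E.
    rewrite /lebN -iintD//; try by apply/measurable_EFinP; exact: measurable_indic.
    apply: le_iint => y; first by rewrite lee_fin indic_ge0.
    rewrite -EFinD lee_fin.
    have [cy|cy] := pselect (ecube x r y); last first.
      by rewrite indicE (_ : y \in _ = false) ?addr_ge0 ?indic_ge0//; apply/negP => /set_mem.
    have ey : eball x e y.
      by apply: ecube_sub_eball cy; rewrite ?(ltW r0)// /e ltr_pM2r// ltr_nat.
    rewrite !indicE (mem_set cy); have [Ay|Ay] := pselect (A y).
      by rewrite (mem_set Ay) lerDr.
    by rewrite (_ : y \in eball x e `\` A) ?lerDl//; apply: mem_set.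
  rewrite lebN_ecube ?(ltW r0)//.
  move: hA (lebN_ge0 (eball x e `\` A)); rewrite -(fineK lebN_level_fin).
  case: (lebN (eball x e `\` A)) => [d| |] //; last by move=> *; rewrite leey.
  rewrite -EFinD -EFinM !lee_fin; lra.
apply: le_iint => y; first by rewrite mule_ge0// lee_fin indic_ge0.
have [[ey nAy]|nD] := pselect ((eball x e `\` A) y); last first.
  rewrite indicE (_ : y \in _ = false) ?mule0; last by apply/negP => /set_mem.
  by rewrite lee_fin; apply: mulr_ge0; [exact/ltW/energy_coef_gt0|rewrite mulr_ge0 ?powR_ge0].
have yD : (eball x e `\` A) y by [].
rewrite indicE (mem_set yD) mule1 lee_fin /k.
rewrite ler_wpM2l ?(ltW (energy_coef_gt0 _))//.
have h0 : 0 <= (th' - th) * m by rewrite mulr_ge0 ?subr_ge0// ltW.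
have bx : 0 < barrier Rad m th' x by apply: le_lt_trans A'x.
have sx := barrier_shift tt bx.
have psix : (th' - th) * m <= psi x.
  rewrite le_max; apply/orP; left; move: A'x; rewrite /A' /undershoot_set/=; lra.
have exy : edist x y < e by rewrite edistC.
(* The lower bound on the negative power fails at distance 0. The points differ since x lies in A
   and y does not. *)
have exy0 : 0 < edist x y.
  rewrite lt_neqAle edist_ge0 andbT eq_sym; apply/negP => /eqP d0.
  apply: nAy; suff -> : y = x by move: A'x sx; rewrite /A' /undershoot_set/=; lra.
  apply: eq_from_tnth => i; apply/esym/eqP; rewrite -subr_eq0 -normr_le0 -d0.
  exact: norm_tnth_le_edist.
apply: ler_pM; rewrite ?powR_ge0//.
  apply: le_powR_pos; rewrite ?(ltW p0)//.
  by rewrite (undershoot_notin nAy) subr0 ger0_norm ?undershoot_ge0.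
apply: le_powR_neg; rewrite ?(ltW exy)//.
by rewrite addr_ge0// ltW.
Qed.

(* Only pairs with x in A and y in the annulus Z are used; there |x - y| lies between Rad / 5 and 2 Rad. *)
Lemma undershoot_tail (th' I : R) (Z : set (N.-tuple R)) :
  th <= th' -> measurable Z -> (forall y, Z y -> Rad / 2 <= enorm y < Rad) ->
  intN Z (fun y => u y `^ (p - 1)) = I%:E ->
  (((th' - th) * m * ((2 * Rad) `^ (- (N%:R + p * s)) * 2^-1 `^ (p - 1)) * I)%:E *
     lebN (undershoot_set Rad m th' u) <=
   (energy_bound * (m `^ p * Rad `^ (- (p * s))))%:E * lebN A +
   (2 * (14 * m) `^ p * (Rad / 5) `^ (- (N%:R + p * s)))%:E * (lebN A * lebN Z))%E.
Proof.
move=> tt mZ ZR IE.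
set A' := undershoot_set Rad m th' u.
have mA' : measurable A' by exact: measurable_undershoot_set.
set kP := (2 * Rad) `^ (- (N%:R + p * s)) * 2^-1 `^ (p - 1).
set kQ := 2 * (14 * m) `^ p * (Rad / 5) `^ (- (N%:R + p * s)).
have kP0 : 0 <= kP by rewrite mulr_ge0 ?powR_ge0.
have kQ0 : 0 <= kQ by rewrite !mulr_ge0 ?powR_ge0.
have Ns0 : 0 <= N%:R + p * s by rewrite addr_ge0// ltW.
pose P x y := kP * psi x * (\1_Z y * u y `^ (p - 1)).
pose Q x y := kQ * (\1_A x * \1_Z y).
have mh : measurable_fun setT (fun y => \1_Z y * u y `^ (p - 1)).
  by apply: measurable_funM; [exact: measurable_indic|exact: measurable_powR_comp].
have mP : measurable2 P.
  apply: measurable_funM; last exact: (measurable2_snd mh).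
  exact: (measurable_funM (measurable_cst _) (measurable2_fst mpsi)).
have mQ1 : measurable2 (fun x y => \1_A x * \1_Z y : R).
  exact: (measurable_funM (measurable_indic_fst mA) (measurable_indic_snd mZ)).
have mQ : measurable2 Q by apply: measurable_funM.
have P0 x y : 0 <= P x y by rewrite /P !mulr_ge0 ?indic_ge0 ?powR_ge0 ?undershoot_ge0.
have Q0 x y : 0 <= Q x y by apply: mulr_ge0 => //; rewrite mulr_ge0 ?indic_ge0.
have h0 : 0 <= (th' - th) * m by rewrite mulr_ge0 ?subr_ge0// ltW.
have Afin := lebN_level_fin.
have Zfin : lebN Z \is a fin_num.
  rewrite ge0_fin_numE ?lebN_ge0//.
  apply: (@le_lt_trans _ _ (lebN (@eball0 R N Rad))).
    by apply: le_lebN => y /ZR /andP[].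
  by rewrite eball0E (le_lt_trans (lebN_eball_le _ (ltW Rad0)))// ltry.
have QE : iint2 (fun x y => (Q x y)%:E) = (kQ%:E * (lebN A * lebN Z))%E.
  rewrite (_ : (fun x y => _) = (fun x y => kQ%:E * (\1_A x * \1_Z y)%:E)%E)//.
  rewrite iint2Z//; last exact/measurable_EFinP.
  rewrite iint2_prod; [|exact: measurable_indic|exact: measurable_indic|exact: indic_ge0|exact: indic_ge0].
  congr (_ * _)%E; rewrite muleC -(fineK Zfin) /lebN -iintZ ?fine_ge0 ?lebN_ge0//; last first.
    by apply/measurable_EFinP; exact: measurable_indic.
  by congr iint; apply/funext => x; rewrite muleC -/(lebN Z) fineK.
have := undershoot_energy mP mQ P0 Q0; rewrite QE => H.
apply: le_trans (H _ _); last 2 first.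
- move=> x y.
  (* Unless x is in A and y in Z, the annulus term vanishes and [kinetic_le] suffices. *)
  have triv : P x y = 0 -> kinetic x y + P x y <= barrier_energy x y + Q x y.
    move=> ->; rewrite addr0; apply: (@le_trans _ _ (barrier_energy x y)); last by rewrite lerDl.
    apply: le_trans (kinetic_le x y); rewrite lerDl.
    by apply: mulr_ge0; [exact/ltW/energy_coef_gt0|rewrite mulr_ge0 ?powR_ge0].
  have [Ax|Ax] := pselect (A x); last first.
    by apply: triv; rewrite /P undershoot_notin// mulr0 mul0r.
  have [Zy|Zy] := pselect (Z y); last first.
    apply: triv; rewrite /P indicE (_ : y \in Z = false) ?mul0r ?mulr0//.
    by apply/negP => /set_mem.
  have /andP[y1 y2] := ZR _ Zy.
  have x1 := undershoot_set_sub Rad0 m0 th01 u0 Ax.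
  have nAy : ~ A y.
    by move=> /(undershoot_set_sub Rad0 m0 th01 u0); have := Rad0; lra.
  (* The gap between the support of the cone and the annulus is 1/2 - 7/24 = 5/24, which exceeds
     1/5. *)
  have exy1 : Rad / 5 <= edist x y.
    by have := enorm_le_edist y x; rewrite edistC; have := Rad0; lra.
  have exy2 : edist x y <= 2 * Rad.
    have := edist_triangle x [tuple of nseq N 0] y.
    by rewrite (edistC [tuple of nseq N 0]) -!enorm_edist; have := Rad0; lra.
  have R50 : 0 < Rad / 5 by rewrite divr_gt0.
  have exy0 : 0 < edist x y by apply: lt_le_trans exy1.
  set k := edist x y `^ (- (N%:R + p * s)).
  have k0 : 0 <= k by rewrite powR_ge0.
  have psiE := undershoot_in Ax.
  have psix0 : 0 <= psi x by exact: undershoot_ge0.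
  have psix : psi x <= 14 * m.
    have := undershoot_le Rad0 m0 th01 u0 x.
    by rewrite indicE mem_set// mulr1.
  apply: (@le_trans _ _ (Q x y)); last by rewrite lerDr barrier_energy_ge0.
  rewrite /kinetic (undershoot_notin nAy) subr0 -powRN -/k /P /Q !indicE (mem_set Ax) (mem_set Zy) !mul1r mulr1.
  apply: (@le_trans _ _ ((spow (u x - u y) (p - 1) * psi x + (u y / 2) `^ (p - 1) * psi x) * k)).
    rewrite mulrDl lerD2l powRM ?invr_ge0// /kP.
    rewrite (_ : _ * _ * _ * _ =
      u y `^ (p - 1) * 2^-1 `^ (p - 1) * psi x * (2 * Rad) `^ (- (N%:R + p * s))); last by ring.
    apply: ler_wpM2l; first by rewrite !mulr_ge0 ?powR_ge0.
    exact: le_powR_neg.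
  have tp := tail_pointwise p1 (u0 x) (u0 y) (ltW Ax) (barrier_le Rad0 m0 th01 x).
  rewrite -psiE in tp.
  apply: (le_trans (ler_wpM2r k0 tp)).
  have m140 : 0 <= 14 * m by rewrite mulr_ge0// ltW.
  rewrite /kQ -(powR_mulr_pred p1 m140) mulrA; apply: ler_pM => //.
  - by rewrite !mulr_ge0 ?powR_ge0.
  - by apply: ler_wpM2l => //; rewrite mulr_ge0 ?powR_ge0.
  - exact: le_powR_neg.
- by rewrite -(fineK Afin) -(fineK Zfin) -!EFinM ltry.
have I0 : 0 <= I.
  by rewrite -lee_fin -IE; apply: iint_ge0 => y; rewrite lee_fin mulr_ge0 ?indic_ge0 ?powR_ge0.
have c0 : 0 <= (th' - th) * m * kP * I by apply: mulr_ge0 => //; exact: mulr_ge0.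
rewrite /lebN -iintZ//; last by apply/measurable_EFinP; exact: measurable_indic.
apply: le_iint => x; first by rewrite mule_ge0// lee_fin ?indic_ge0.
rewrite /P (_ : (fun y => _) = (fun y => (kP * psi x)%:E * (\1_Z y * u y `^ (p - 1))%:E)%E)//.
have px0 : 0 <= kP * psi x by apply: mulr_ge0 => //; exact: undershoot_ge0.
rewrite iintZ//; last 2 first.
- exact/measurable_EFinP.
- by move=> y; rewrite lee_fin mulr_ge0 ?indic_ge0 ?powR_ge0.
have -> : iint (fun y => (\1_Z y * u y `^ (p - 1))%:E) = I%:E by rewrite -IE.
rewrite -!EFinM lee_fin.
have [A'x|nA'x] := pselect (A' x); last first.
  have -> : \1_A' x = 0 :> R by rewrite indicE (_ : x \in A' = false)//; apply/negP => /set_mem.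
  by rewrite mulr0; exact: mulr_ge0.
rewrite indicE mem_set// mulr1 ler_wpM2r// mulrC ler_wpM2l//.
have bx : 0 < barrier Rad m th' x by apply: le_lt_trans A'x.
have sx := barrier_shift tt bx.
rewrite /undershoot le_max; apply/orP; left; move: A'x sx; rewrite /A' /undershoot_set/=; lra.
Qed.

End Level.
End Energy.

(** * The De Giorgi iteration with shrinking radii *)

Section Iteration.
Context {R : realType} {N : nat}.
Implicit Types x y : N.-tuple R.
Variables (s p : R).
Hypotheses (N0 : (0 < N)%N) (s01 : 0 < s < 1) (p1 : 1 < p).

Let p0 : 0 < p. Proof. exact: lt_trans p1. Qed.
Let s0 : 0 < s. Proof. by case/andP: s01. Qed.
Let ps0 : 0 < p * s. Proof. by rewrite mulr_gt0. Qed.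

(** Quotient of the two coefficients of [undershoot_decay]: m cancels, and what remains beside it is
    (th' - th)^(-p) (r / Rad)^(ps). *)
Definition decay_const : R :=
  energy_bound (N := N) s p * 2 * N.+1%:R `^ (N%:R + p * s) / (energy_coef p * 2 ^+ N).

Lemma decay_const_gt0 : 0 < decay_const.
Proof.
have := energy_bound_gt0 (N := N) s01 p1; have := energy_coef_gt0 p => h1 h2.
by rewrite divr_gt0// ?mulr_gt0 ?powR_gt0 ?exprn_gt0.
Qed.

(* The radii shrink by a factor chosen so that mu^(p s) = 2^-p beats the loss (th' - th)^-p. *)
Definition radius_ratio : R := 2 `^ (- s^-1).

Lemma radius_ratio_gt0 : 0 < radius_ratio. Proof. by rewrite powR_gt0. Qed.

Lemma radius_ratio_lt1 : radius_ratio < 1.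
Proof.
have h : 0 < s^-1 by rewrite invr_gt0.
rewrite /radius_ratio -mulN1r powRrM powR_inv1// powR_lt1//.
by rewrite invr_gt0 ltr0n invf_lt1// ltr1n.
Qed.

(** The level gaps are 2^-(j+2), so their power -p is 4^p 2^(pj); the shrinking radii cancel 2^(pj),
    and the factor 4^p is left to this radius. It makes the contraction factor of each step equal to
    [radius_ratio] to the power N, the rate at which the cubes shrink. *)
Definition start_radius : R :=
  (radius_ratio ^+ N / (decay_const * 4 `^ p)) `^ (p * s)^-1.

Lemma start_radius_gt0 : 0 < start_radius.
Proof.
have := decay_const_gt0; have := radius_ratio_gt0 => h1 h2.
apply: powR_gt0; apply: divr_gt0; first exact: exprn_gt0.
by apply: mulr_gt0 => //; exact: powR_gt0.
Qed.

Lemma start_radius_powR : decay_const * 4 `^ p * start_radius `^ (p * s) = radius_ratio ^+ N.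
Proof.
have D0 : 0 < decay_const * 4 `^ p by rewrite mulr_gt0 ?decay_const_gt0 ?powR_gt0.
rewrite /start_radius -powRrM mulVf ?gt_eqF// powRr1; last first.
  by rewrite ltW// divr_gt0// exprn_gt0// radius_ratio_gt0.
by rewrite mulrC divfK// gt_eqF.
Qed.

Variables (Rad m K : R).
Hypotheses (Rad0 : 0 < Rad) (m0 : 0 < m) (K0 : 0 <= K) (KRm : K * Rad `^ (p * s) <= m `^ (p - 1)).
Variables (u : N.-tuple R -> R) (U : set (N.-tuple R)).
Hypotheses (mu : measurable_fun setT u) (u0 : forall x, 0 <= u x).
Hypotheses (BU : eball0 N (Rad / 3) `<=` U) (WU : Wsp s p U u).
Hypothesis superu : weak_super s p K (eball0 N (Rad / 3)) u.

Local Notation A th := (undershoot_set Rad m th u).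
Let vol th : R := fine (lebN (A th)).

Let volE th : 0 <= th <= 1 -> lebN (A th) = (vol th)%:E.
Proof. by move=> th01; rewrite fineK; last exact: lebN_level_fin. Qed.

Let vol_ge0 th : 0 <= vol th. Proof. exact: (fine_ge0 (lebN_ge0 _)). Qed.

Lemma undershoot_decay_real th th' r : 0 <= th -> th < th' -> th' <= 1 -> 0 < r ->
  2 * vol th <= (2 * r) ^+ N ->
  vol th' <= decay_const * (th' - th) `^ (- p) * (r / Rad) `^ (p * s) * vol th.
Proof.
move=> t0 tt t1 r0 h.
have th01 : 0 <= th <= 1 by rewrite t0 (le_trans (ltW tt)).
have th01' : 0 <= th' <= 1 by rewrite t1 (le_trans t0 (ltW tt)).
have := undershoot_decay s01 p1 Rad0 m0 K0 KRm mu u0 BU WU superu th01 (ltW tt) r0.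
rewrite !volE// -!EFinM !lee_fin => /(_ h).
have d0 : 0 < th' - th by rewrite subr_gt0.
have c0 := energy_coef_gt0 p.
have Ns0 : 0 < N%:R + p * s by rewrite ltr_wpDl.
set e := energy_bound _ _.
rewrite !powRM ?(ltW d0) ?(ltW m0) ?(ltW r0)//; last by rewrite invr_ge0 ltW.
rewrite -[Rad^-1]powR_inv1 ?(ltW Rad0)// -powRrM mulN1r exprMn.
rewrite [r `^ (- _)](_ : _ = r `^ (- (p * s)) / r ^+ N); last first.
  by rewrite opprD addrC powR_addr// [r `^ (- N%:R)]powRN powR_mulrn// ltW.
rewrite !powRN => H.
have m1 : 0 < m `^ p by rewrite powR_gt0.
have d1 : 0 < (th' - th) `^ p by rewrite powR_gt0.
have r1 : 0 < r `^ (p * s) by rewrite powR_gt0.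
have rN : 0 < r ^+ N by rewrite exprn_gt0.
have N1 : 0 < N.+1%:R `^ (N%:R + p * s) :> R by rewrite powR_gt0.
have R1 : 0 < Rad `^ (p * s) by rewrite powR_gt0.
have T : 0 < (2 : R) ^+ N by rewrite exprn_gt0.
rewrite /decay_const -/e.
set D := (th' - th) `^ p in H d1 *; set M := m `^ p in H m1 *.
set X := r `^ (p * s) in H r1 *; set Y := r ^+ N in H rN *.
set Z := N.+1%:R `^ _ in H N1 *; set V := Rad `^ _ in H R1 *.
set W := 2 ^+ N in H T *; set c := energy_coef p in H c0 *.
have g : 0 < c * (D * M * (Z^-1 * (X^-1 / Y))) * (W * Y / 2).
  by rewrite !mulr_gt0 ?invr_gt0.
rewrite -(ler_pM2l g); apply: (le_trans H); rewrite le_eqVlt; apply/orP; left; apply/eqP.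
by field; rewrite !gt_eqF.
Qed.

(** If twice the volume of A_th_j is at most (2 r_j)^N, one step multiplies both sides by at most,
    respectively exactly, the same factor q, so the condition persists. The volumes then decay like
    q^j, and A_1 lies in every A_th_j. *)
Lemma undershoot_set_null : 2 * vol 2^-1 <= (2 * (start_radius * Rad)) ^+ N ->
  lebN (A 1) = 0%E.
Proof.
move=> h0.
pose h : R := 2^-1.
have h1 : 0 < h by rewrite invr_gt0.
pose th j := 1 - h ^+ j.+1.
pose r j := start_radius * Rad * radius_ratio ^+ j.
have r0 j : 0 < r j by rewrite !mulr_gt0 ?exprn_gt0 ?start_radius_gt0 ?radius_ratio_gt0.
have hle j : h ^+ j <= 1 by rewrite exprn_ile1 ?(ltW h1)// invf_le1// ler1n.
have th0 j : 0 <= th j by rewrite subr_ge0.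
have th1 j : th j < 1 by rewrite ltrBlDr ltrDl exprn_gt0.
have thS j : th j.+1 - th j = h ^+ j.+2.
  have e : h ^+ j.+1 = 2 * h ^+ j.+2 by rewrite [h ^+ j.+2]exprS mulrA divff// mul1r.
  by rewrite /th; lra.
have mun := radius_ratio_gt0.
pose q := radius_ratio ^+ N.
have q0 : 0 < q by rewrite exprn_gt0.
have step j : 2 * vol (th j) <= (2 * r j) ^+ N -> vol (th j.+1) <= q * vol (th j).
  move=> H; have hlt : th j < th j.+1 by rewrite -subr_gt0 thS exprn_gt0.
  apply: (le_trans (undershoot_decay_real (th0 j) hlt (ltW (th1 _)) (r0 j) H)).
  rewrite thS /q -start_radius_powR ler_wpM2r// le_eqVlt; apply/orP; left; apply/eqP.
  rewrite (_ : r j / Rad = start_radius * radius_ratio ^+ j); last first.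
    by rewrite /r; field; rewrite gt_eqF.
  rewrite powRM ?(ltW start_radius_gt0) ?exprn_ge0 ?(ltW mun)//.
  set D := decay_const; set S := start_radius `^ _.
  rewrite !powR_exprn ?(ltW h1) ?(ltW mun)//.
  rewrite (_ : radius_ratio `^ (p * s) = h `^ p); last first.
    rewrite /radius_ratio -powRrM (_ : - s^-1 * (p * s) = - p); last by field; rewrite gt_eqF.
    by rewrite -mulN1r powRrM powR_inv1.
  rewrite -(mulN1r p) powRrM powR_inv1 ?(ltW h1)// (_ : h^-1 = 2) ?invrK//.
  rewrite (_ : 4 = 2 ^+ 2) ?powR_exprn//; last by rewrite -natrX.
  have hp : 2 `^ p * h `^ p = 1 by rewrite -powRM ?(ltW h1)// divff// one_powR.
  transitivity (D * S * (2 `^ p) ^+ 2 * (2 `^ p * h `^ p) ^+ j); last by rewrite hp expr1n; ring.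
  by rewrite exprMn !exprSr; ring.
have inv j : 2 * vol (th j) <= (2 * r j) ^+ N.
  elim: j => [|j IH]; first by rewrite /th /r expr1 expr0 mulr1 (_ : 1 - h = 2^-1)//; rewrite /h; field.
  apply: (@le_trans _ _ (q * (2 * vol (th j)))); first by have := step j IH; lra.
  apply: (le_trans (ler_wpM2l (ltW q0) IH)).
  rewrite le_eqVlt; apply/orP; left; apply/eqP.
  by rewrite /q /r -exprMn exprSr; congr (_ ^+ _); ring.
(* Positive dimension matters here: for N = 0 the factor q would be 1. *)
have q1 : q < 1 by rewrite exprn_ilt1 ?(ltW mun) ?radius_ratio_lt1// -lt0n.
have geo j : vol (th j) <= vol (th 0%N) * q ^+ j.
  elim: j => [|j IH]; first by rewrite expr0 mulr1.
  apply: (le_trans (step j (inv j))); rewrite exprS mulrCA.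
  by apply: ler_wpM2l; rewrite ?(ltW q0).
have t1 : 0 <= (1 : R) <= 1 by rewrite ler01 lexx.
have A1 j : vol 1 <= vol (th j).
  have tj : 0 <= th j <= 1 by rewrite th0 ltW.
  rewrite -lee_fin -!volE//; apply: le_lebN => x; rewrite /undershoot_set/= => Ax.
  have bx : 0 < barrier Rad m 1 x by apply: le_lt_trans Ax.
  have := barrier_shift (ltW (th1 j)) bx.
  have : 0 <= (1 - th j) * m by rewrite mulr_ge0 ?subr_ge0 ?ltW.
  lra.
rewrite volE//; congr EFin; apply/eqP; rewrite eq_le vol_ge0 andbT.
have cv : geometric (vol (th 0%N)) q @ \oo --> (0 : R).
  by apply: cvg_geometric; rewrite ger0_norm// ltW.
have := @limr_ge _ _ _ _ (vol 1) (geometric (vol (th 0%N)) q) (cvgP _ cv).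
rewrite (cvg_lim _ cv)//; apply.
by apply: nearW => j; apply: le_trans (A1 j) (geo j).
Qed.

End Iteration.

(** * The choice of sigma and the smallness of the starting set *)

Section HarnackConstant.
Context {R : realType} {N : nat}.
Implicit Types x y : N.-tuple R.

(** The annulus contains the ball of radius Rad / 4 about the point (3 Rad / 4, 0, ..., 0), and in
    it a cube of half-side Rad / (4 (N + 1)). *)
Lemma lebN_annulus_ge (Rad : R) : (0 < N)%N -> 0 < Rad ->
  (((Rad / (2 * N.+1%:R)) ^+ N)%:E <= lebN (@eball0 R N Rad `\` eball0 N (Rad / 2)))%E.
Proof.
case: N => // n _ R0.
pose c : n.+1.-tuple R := [tuple of 3 / 4 * Rad :: nseq n 0].
have ec : enorm c = 3 / 4 * Rad.
  rewrite /enorm big_ord_recl tnth0 big1 => [|i _]; last first.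
    by rewrite tnthS (tnth_nth 0)/= nth_nseq if_same expr0n.
  by rewrite addr0 sqrtr_sqr ger0_norm// mulr_ge0// ltW.
have r0 : 0 < Rad / (4 * n.+2%:R) by rewrite divr_gt0.
have -> : Rad / (2 * n.+2%:R) = 2 * (Rad / (4 * n.+2%:R)) by field.
rewrite -(lebN_ecube c) ?(ltW r0)//; apply: le_lebN => x cx.
have : eball c (Rad / 4) x.
  apply: ecube_sub_eball cx; first exact: ltW.
  rewrite (_ : Rad / 4 = n.+2%:R * (Rad / (4 * n.+2%:R))); last by field.
  by rewrite ltr_pM2r// ltr_nat.
rewrite /eball/= => xc; split; rewrite /eball0/=.
  have := enorm_le_edist x c; rewrite ec; lra.
apply/negP; rewrite -leNgt.
have := enorm_le_edist c x; rewrite ec edistC; lra.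
Qed.

Variables (s p : R).
Hypotheses (N0 : (0 < N)%N) (s01 : 0 < s < 1) (p1 : 1 < p).

Let ps0 : 0 < p * s. Proof. by case/andP: s01 => s0 _; rewrite mulr_gt0// (lt_trans _ p1). Qed.

(** In order: the gap between the levels 0 and 1/2, the kernel at distance 2 [Rad], the halving of
    u(y) in [tail_pointwise], and the volume of the annulus from below, all without their powers of
    [Rad]. *)
Definition tail_const : R := 2^-1 * 2 `^ (- (N%:R + p * s)) * 2^-1 `^ (p - 1) / (2 * N.+1%:R) ^+ N.
(** The right side of [undershoot_tail] in units of m^p Rad^(N-ps), with the volumes of A_0 and of
    the annulus each bounded by (2 Rad)^N. *)
Definition excess_const : R :=
  energy_bound (N := N) s p * 2 ^+ N + 2 * 14 `^ p * 5 `^ (N%:R + p * s) * 4 ^+ N.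

Lemma tail_const_gt0 : 0 < tail_const.
Proof. by rewrite divr_gt0 ?mulr_gt0 ?powR_gt0 ?exprn_gt0// ?invr_gt0// mulr_gt0. Qed.

Lemma excess_const_gt0 : 0 < excess_const.
Proof.
have := energy_bound_gt0 (N := N) s01 p1 => h.
by apply: addr_gt0; rewrite !mulr_gt0 ?powR_gt0 ?exprn_gt0.
Qed.

(** Largest value of sigma^(p-1) for which |A_1/2| <= sigma^(p-1) Rad^N [excess_const] /
    [tail_const] fulfils the starting condition of [undershoot_set_null]. The minimum in
    [harnack_sigma] only ensures sigma < 1. *)
Definition harnack_power : R :=
  (2 * start_radius (N := N) s p) ^+ N * tail_const / (2 * excess_const).

Definition harnack_sigma : R := Num.min 2^-1 (harnack_power `^ (p - 1)^-1).

Lemma harnack_power_gt0 : 0 < harnack_power.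
Proof.
have := start_radius_gt0 (N := N) s01 p1 => h.
apply: divr_gt0; last by rewrite mulr_gt0// excess_const_gt0.
by rewrite mulr_gt0 ?tail_const_gt0// exprn_gt0// mulr_gt0.
Qed.

Lemma harnack_sigma_gt0 : 0 < harnack_sigma.
Proof. by rewrite lt_min invr_gt0 ltr0n/= powR_gt0// harnack_power_gt0. Qed.

Lemma harnack_sigma_lt1 : harnack_sigma < 1.
Proof. by rewrite gt_min invf_lt1// ltr1n. Qed.

Lemma harnack_sigma_le : harnack_sigma `^ (p - 1) <= harnack_power.
Proof.
have q0 : 0 < p - 1 by rewrite subr_gt0.
have E : (harnack_power `^ (p - 1)^-1) `^ (p - 1) = harnack_power.
  by rewrite -powRrM mulVf ?gt_eqF// powRr1// ltW// harnack_power_gt0.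
rewrite -[leRHS]E; apply: le_powR_pos; rewrite ?(ltW q0) ?(ltW harnack_sigma_gt0)//.
by rewrite ge_min lexx orbT.
Qed.

Variables (Rad m K : R).
Hypotheses (Rad0 : 0 < Rad) (m0 : 0 < m) (K0 : 0 <= K) (KRm : K * Rad `^ (p * s) <= m `^ (p - 1)).
Variables (u : N.-tuple R -> R) (U : set (N.-tuple R)).
Hypotheses (mu : measurable_fun setT u) (u0 : forall x, 0 <= u x).
Hypotheses (BU : eball0 N (Rad / 3) `<=` U) (WU : Wsp s p U u).
Hypothesis superu : weak_super s p K (eball0 N (Rad / 3)) u.

Lemma weak_harnack_level (I : R) :
  let Z := eball0 N Rad `\` eball0 N (Rad / 2) in
  intN Z (fun y => u y `^ (p - 1)) = I%:E ->
  m `^ (p - 1) * fine (lebN Z) <= harnack_sigma `^ (p - 1) * I ->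
  lebN (undershoot_set Rad m 1 u) = 0%E.
Proof.
move=> Z IE mI.
have mZ : measurable Z by apply: measurableD; exact: measurable_eball0.
have ZR y : Z y -> Rad / 2 <= enorm y < Rad.
  by rewrite /Z /eball0/= => -[-> /negP]; rewrite -leNgt => ->.
have Zle : (lebN Z <= ((2 * Rad) ^+ N)%:E)%E.
  apply: le_trans (lebN_eball_le [tuple of nseq N 0] (ltW Rad0)).
  by rewrite -eball0E; apply: le_lebN => y [].
have Zfin : lebN Z \is a fin_num.
  by rewrite ge0_fin_numE ?lebN_ge0// (le_lt_trans Zle)// ltry.
have Zge := lebN_annulus_ge N0 Rad0; rewrite -/Z in Zge.
have t0 : 0 <= (0 : R) <= 1 by rewrite lexx ler01.
have th : 0 <= (2^-1 : R) <= 1 by rewrite invr_ge0 ler0n/= invf_le1// ler1n.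
have tail := undershoot_tail s01 p1 Rad0 m0 K0 KRm mu u0 BU WU superu t0 (th' := 2^-1) (I := I) (Z := Z).
move: tail => /(_ _ mZ ZR IE); rewrite invr_ge0 ler0n => /(_ isT) tail.
have A0fin := lebN_level_fin Rad0 m0 u0 t0.
have Ahfin := lebN_level_fin Rad0 m0 u0 th.
have A0le := lebN_undershoot_set Rad0 m0 t0 u0.
apply: (undershoot_set_null N0 s01 p1 Rad0 m0 K0 KRm mu u0 BU WU superu).
move: A0le Zle Zge mI tail; rewrite -(fineK Zfin) -(fineK A0fin) -(fineK Ahfin) /=.
rewrite -!EFinM !lee_fin subr0.
have := fine_ge0 (lebN_ge0 (undershoot_set Rad m 0 u)).
have := fine_ge0 (lebN_ge0 (undershoot_set Rad m 2^-1 u)).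
move: (fine (lebN (undershoot_set Rad m 0 u))) => v0.
move: (fine (lebN (undershoot_set Rad m 2^-1 u))) => vh.
move: (fine (lebN Z)) => z vh0 v00 v0le zle zge mI tail.
have S0 : 0 < harnack_sigma `^ (p - 1) by rewrite powR_gt0// harnack_sigma_gt0.
have S1 := harnack_sigma_le.
move: (harnack_sigma `^ (p - 1)) S0 S1 mI => S S0 S1 mI.
have eb0 := energy_bound_gt0 (N := N) s01 p1.
set L := (X in X <= _) in tail; set T := (X in _ <= X) in tail; rename tail into LT.
pose G := m `^ p * Rad `^ (- (p * s)).
have G0 : 0 < G by rewrite mulr_gt0 ?powR_gt0.
have mp0 : 0 < m `^ (p - 1) by rewrite powR_gt0.
have RN0 : 0 < Rad ^+ N by rewrite exprn_gt0.
have kE (c : R) : 0 < c -> (c * Rad) `^ (- (N%:R + p * s)) = c `^ (- (N%:R + p * s)) * Rad `^ (- (p * s)) / Rad ^+ N.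
  move=> c0; rewrite powRM ?(ltW c0) ?(ltW Rad0)// -mulrA; congr (_ * _).
  by rewrite opprD addrC powR_addr// [Rad `^ (- N%:R)]powRN powR_mulrn// ltW.
(* Multiplication by S = sigma^(p-1) eliminates the unknown I: by [mI], S I is at least m^(p-1) |Z|,
   so the left side acquires the factor [G] of the right side, which then cancels. *)
have L1 : G * tail_const * vh <= S * L.
  have Ige : m `^ (p - 1) * (Rad / (2 * N.+1%:R)) ^+ N <= S * I.
    by apply: le_trans mI; rewrite ler_wpM2l// ltW.
  rewrite /L kE// (_ : S * _ =
    2^-1 * m * (2 `^ (- (N%:R + p * s)) * Rad `^ (- (p * s)) / Rad ^+ N * 2^-1 `^ (p - 1)) * vh * (S * I)); last by ring.
  apply: le_trans (ler_wpM2l _ Ige); last first.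
    by rewrite !mulr_ge0 ?powR_ge0 ?invr_ge0 ?exprn_ge0 ?(ltW m0) ?(ltW Rad0).
  rewrite /G /tail_const -(powR_mulr_pred p1 (ltW m0)) expr_div_n le_eqVlt; apply/orP; left; apply/eqP.
  set X := (2 * _) ^+ N; have X0 : 0 < X by rewrite exprn_gt0// mulr_gt0.
  set Y := Rad ^+ N in RN0 *; field; rewrite !gt_eqF//.
have T1 : T <= G * excess_const * Rad ^+ N.
  apply: (@le_trans _ _ (energy_bound (N := N) s p * G * (2 * Rad) ^+ N +
      2 * (14 * m) `^ p * (Rad / 5) `^ (- (N%:R + p * s)) * ((2 * Rad) ^+ N * (2 * Rad) ^+ N))).
    apply: lerD; first by rewrite ler_wpM2l// mulr_ge0 ?(ltW eb0) ?(ltW G0).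
    apply: ler_wpM2l; first by rewrite !mulr_ge0 ?powR_ge0.
    apply: ler_pM => //.
    by apply: le_trans zge; rewrite exprn_ge0// divr_ge0 ?mulr_ge0// ltW.
  rewrite (mulrC Rad) kE ?invr_gt0// powRM ?(ltW m0)// -[5^-1]powR_inv1// -powRrM mulN1r opprK.
  rewrite le_eqVlt; apply/orP; left; apply/eqP; rewrite /G /excess_const !exprMn.
  rewrite (_ : 4 = 2 * 2) ?exprMn; last by rewrite -natrM.
  set Y := Rad ^+ N in RN0 *; field; rewrite gt_eqF//.
have F : tail_const * vh <= S * (excess_const * Rad ^+ N).
  rewrite -(ler_pM2l G0) (mulrA G); apply: (le_trans L1).
  apply: (le_trans (ler_wpM2l (ltW S0) (le_trans LT T1))).
  by rewrite le_eqVlt; apply/orP; left; apply/eqP; ring.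
have F2 : tail_const * vh <= harnack_power * (excess_const * Rad ^+ N).
  by apply: (le_trans F); rewrite ler_wpM2r// mulr_ge0 ?(ltW excess_const_gt0) ?(ltW RN0).
have e0 := excess_const_gt0; have c0 := tail_const_gt0.
have hp : 2 * (harnack_power * (excess_const * Rad ^+ N)) = tail_const * (2 * (start_radius (N := N) s p * Rad)) ^+ N.
  rewrite (mulrA 2 (start_radius _ _)) exprMn /harnack_power.
  move: (excess_const) e0 (tail_const) ((2 * _) ^+ N) (Rad ^+ N) => E' e0 c X Y.
  by field; rewrite gt_eqF.
rewrite -(ler_pM2l c0) -hp mulrCA; exact: ler_wpM2l.
Qed.

End HarnackConstant.

(** * Reduction from u >= 0 almost everywhere to u >= 0 everywhere *)

Section PositivePart.
Context {R : realType} {N : nat}.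
Implicit Types x y : N.-tuple R.
Variable u : N.-tuple R -> R.
Hypotheses (mu : measurable_fun setT u) (u0 : ae_in setT (fun x => 0 <= u x)).

Let v x := Num.max (u x) 0.
Let B := [set x | u x < 0].

Let mv : measurable_fun setT v. Proof. exact: measurable_maxr. Qed.

Let mB : measurable B. Proof. exact: measurable_set_ltr. Qed.

Let vE x : ~ B x -> v x = u x.
Proof. by move=> /negP; rewrite -leNgt => h; apply/max_idPl. Qed.

Lemma lebN_neg_set : lebN B = 0%E.
Proof.
rewrite -[RHS]u0; congr lebN; apply/seteqP; split => x /=.
  by rewrite /B/= => h; split => //; apply/negP; rewrite -ltNge.
by case=> _ /negP; rewrite -ltNge.
Qed.

(** The null set is discarded in the outer variable, and for each remaining x again in the inner
    one. Hence the positive part satisfies the same weak inequality as u. *)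
Lemma eq_iint2_null (f g : N.-tuple R -> N.-tuple R -> \bar R) :
  measurable2 f -> measurable2 g ->
  (forall x y, 0 <= f x y)%E -> (forall x y, 0 <= g x y)%E ->
  (forall x y, ~ B x -> ~ B y -> f x y = g x y) -> iint2 f = iint2 g.
Proof.
move=> mf mg f0 g0 fg; apply: (eq_iint_null mB lebN_neg_set).
- exact: measurable2_iint.
- exact: measurable2_iint.
- by move=> x; exact: iint_ge0.
- by move=> x; exact: iint_ge0.
move=> x Bx; apply: (eq_iint_null mB lebN_neg_set) => //; try exact: measurable2_section.
by move=> y By; exact: fg.
Qed.

Lemma weak_super_pos_part (s p K : R) Om : weak_super s p K Om u -> weak_super s p K Om v.
Proof.
move=> H phi W0 phi0; have [[mphi _] _] := W0; apply: (le_trans (H phi W0 phi0)).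
rewrite le_eqVlt; apply/orP; left; apply/eqP.
have mF := measurable2_nonlocal_form p (N%:R + p * s) mu mphi.
have mG := measurable2_nonlocal_form p (N%:R + p * s) mv mphi.
rewrite /dintN; congr (_ - _)%E; apply: eq_iint2_null.
- by apply/measurable_EFinP; apply: measurable_maxr.
- by apply/measurable_EFinP; apply: measurable_maxr.
- by move=> x y; rewrite lee_fin le_max lexx orbT.
- by move=> x y; rewrite lee_fin le_max lexx orbT.
- by move=> x y Bx By; rewrite !vE.
- by apply/measurable_EFinP; apply: measurable_maxr => //; exact: measurable_funN.
- by apply/measurable_EFinP; apply: measurable_maxr => //; exact: measurable_funN.
- by move=> x y; rewrite lee_fin le_max lexx orbT.
- by move=> x y; rewrite lee_fin le_max lexx orbT.
- by move=> x y Bx By; rewrite !vE.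
Qed.

Lemma Wsp_pos_part (s p : R) U : 0 <= p -> Wsp s p U u -> Wsp s p U v.
Proof.
move=> p0 [_ [Lu Gu]]; split; first exact: mv.
split.
  apply: le_lt_trans Lu; apply: le_iint => x; rewrite lee_fin.
    by rewrite mulr_ge0 ?indic_ge0 ?powR_ge0.
  apply: ler_wpM2l; first exact: indic_ge0.
  apply: le_powR_pos => //; rewrite /v; have [h|h] := leP (u x) 0; last by [].
  by rewrite normr0.
apply: le_lt_trans Gu; apply: le_iint2 => x y; rewrite lee_fin.
  by rewrite !mulr_ge0 ?indic_ge0 ?invr_ge0 ?powR_ge0.
apply: ler_wpM2l; first by rewrite mulr_ge0 ?indic_ge0.
apply: ler_wpM2r; first by rewrite invr_ge0 powR_ge0.
by apply: le_powR_pos => //; exact: norm_max0_sub_le.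
Qed.

Lemma intN_powR_pos_part (q : R) Z : measurable Z ->
  intN Z (fun x => v x `^ q) = intN Z (fun x => u x `^ q).
Proof.
have mM w : measurable_fun setT w -> measurable Z ->
    measurable_fun setT (fun x => (\1_Z x * w x `^ q)%:E : \bar R).
  move=> mw mZ; apply/measurable_EFinP; apply: measurable_funM.
    exact: measurable_indic.
  exact: measurable_powR_comp.
move=> mZ; apply: (eq_iint_null mB lebN_neg_set); try exact: mM.
- by move=> x; rewrite lee_fin mulr_ge0 ?indic_ge0 ?powR_ge0.
- by move=> x; rewrite lee_fin mulr_ge0 ?indic_ge0 ?powR_ge0.
- by move=> x Bx; rewrite vE.
Qed.

(** Disposes of the case in which the claimed lower bound is not positive. *)
Lemma essinf_ge_nonpos A (c : R) : c <= 0 -> (c%:E <= essinf A u)%E.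
Proof.
move=> c0; apply: ereal_sup_ubound; exists c => //; rewrite /ae_in.
apply/eqP; rewrite eq_le lebN_ge0 andbT -lebN_neg_set; apply: le_lebN => x [_ /negP] /=.
by rewrite -ltNge => h; exact: lt_le_trans h c0.
Qed.

End PositivePart.

(** The integrand is at most 1 + |u|^p, and both terms have finite integral over a ball. *)
Lemma Lploc_intN_fin (R : realType) (N : nat) (p r : R) (u : N.-tuple R -> R)
    (Z : set (N.-tuple R)) : 1 < p -> 0 < r -> Z `<=` eball0 N r -> Lploc p u ->
  (intN Z (fun x => u x `^ (p - 1))%R < +oo)%E.
Proof.
move=> p1 r0 Zr [mu Lu]; have := Lu r r0.
set I := intN _ _ => Ioo.
have mb : measurable (@eball0 R N r) by exact: measurable_eball0.
have mf : measurable_fun setT (fun x => (\1_(eball0 N r) x * `|u x| `^ p)%:E).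
  apply/measurable_EFinP; apply: measurable_funM; first exact: measurable_indic.
  by apply: measurable_powR_comp; apply: (measurableT_comp (@normr_measurable R setT)).
apply: (@le_lt_trans _ _ (iint (fun x => (\1_(eball0 N r) x)%:E + (\1_(eball0 N r) x * `|u x| `^ p)%:E)%E)).
  apply: le_iint => x; first by rewrite lee_fin mulr_ge0 ?indic_ge0 ?powR_ge0.
  rewrite -EFinD lee_fin.
  have [Zx|Zx] := pselect (Z x); last first.
    rewrite [\1_Z x](_ : _ = 0) ?mul0r; last first.
      by rewrite indicE (_ : x \in Z = false)//; apply/negP => /set_mem.
    by rewrite addr_ge0 ?mulr_ge0 ?indic_ge0 ?powR_ge0.
  rewrite !indicE (mem_set Zx) (mem_set (Zr _ Zx)) !mul1r.
  have [h|h] := leP `|u x| 1.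
    apply: (@le_trans _ _ 1); last by rewrite lerDl powR_ge0.
    rewrite -(ger0_norm (powR_ge0 _ _)).
    have [h0|h0] := ltP (u x) 0.
      (* The power of a negative base is 1 by convention, its logarithm being set to 0. *)
      by rewrite /powR (lt_eqF h0) ln0 ?(ltW h0)// mulr0 expR0 normr1.
    rewrite ger0_norm ?powR_ge0// -[leRHS](one_powR (p - 1)); apply: le_powR_pos => //.
      by apply: le_trans h; exact: ler_norm.
    by rewrite subr_ge0 ltW.
  have [h0|h0] := ltP (u x) 0.
    by rewrite {1}/powR (lt_eqF h0) ln0 ?(ltW h0)// mulr0 expR0 lerDl powR_ge0.
  rewrite ger0_norm// in h *; apply: (@le_trans _ _ (u x `^ p)); last by rewrite lerDr.
  by apply: ler_powR; [exact: ltW|rewrite gerBl].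
rewrite iintD//; last by apply/measurable_EFinP; exact: measurable_indic.
apply: lte_add_pinfty => //; rewrite -/(lebN _) eball0E.
by apply: le_lt_trans (lebN_eball_le _ (ltW r0)) _; rewrite ltry.
Qed.

Theorem theorem5p2 (R : realType) (N : nat) (s p : R) :
  (0 < N)%N -> 0 < s < 1 -> 1 < p ->
  exists sigma : R, exists Cbar : R, 0 < sigma < 1 /\ 0 < Cbar /\
  forall (Rad K : R) (u : N.-tuple R -> R),
    0 < Rad -> 0 <= K ->
    tWsp s p (eball0 N (Rad / 3)) u ->
    weak_super s p K (eball0 N (Rad / 3)) u ->
    ae_in setT (fun x => 0 <= u x) ->
    let A := eball0 N Rad `\` eball0 N (Rad / 2) in
    (essinf (eball0 N (Rad / 4)) u >=
       sigma%:E * ((fine (lebN A))^-1%:E * intN A (fun x => u x `^ (p - 1))%R)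
                    `^ (p - 1)^-1%R
       - (Cbar * (K * Rad `^ (p * s)) `^ (p - 1)^-1)%:E)%E.
Proof.
move=> N0 s01 p1; exists (harnack_sigma (N := N) s p), 1.
have sig0 := harnack_sigma_gt0 (N := N) s01 p1.
split; first by rewrite sig0 (harnack_sigma_lt1 (N := N)).
split => // Rad K u Rad0 K0 [Lu [[U [_ [_ [BU WU]]]] _]] superu u0; cbv zeta.
set A := eball0 N Rad `\` eball0 N (Rad / 2).
have mu : measurable_fun setT u by case: Lu.
have q0 : 0 < p - 1 by rewrite subr_gt0.
have qV0 : 0 < (p - 1)^-1 by rewrite invr_gt0.
have mA : measurable A by apply: measurableD; exact: measurable_eball0.
have Ifin : intN A (fun x => u x `^ (p - 1)) \is a fin_num.
  rewrite ge0_fin_numE; last first.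
    by apply: iint_ge0 => x; rewrite lee_fin mulr_ge0 ?indic_ge0 ?powR_ge0.
  by apply: (Lploc_intN_fin p1 Rad0 _ Lu) => x [].
set I := fine (intN A (fun x => u x `^ (p - 1))).
have IE : intN A (fun x => u x `^ (p - 1)) = I%:E by rewrite fineK.
have I0 : 0 <= I.
  by rewrite fine_ge0//; apply: iint_ge0 => x; rewrite lee_fin mulr_ge0 ?indic_ge0 ?powR_ge0.
have a0 : 0 < fine (lebN A).
  have Age := lebN_annulus_ge N0 Rad0; rewrite -/A in Age.
  have Afin : lebN A \is a fin_num.
    rewrite ge0_fin_numE ?lebN_ge0//.
    apply: (@le_lt_trans _ _ (lebN (@eball0 R N Rad))); first by apply: le_lebN => y [].
    by rewrite eball0E (le_lt_trans (lebN_eball_le _ (ltW Rad0)))// ltry.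
  move: Age; rewrite -(fineK Afin) lee_fin; apply: lt_le_trans.
  by rewrite exprn_gt0// divr_gt0// mulr_gt0.
rewrite IE -EFinM -EFinB mul1r.
set L := ((fine (lebN A))^-1 * I) `^ (p - 1)^-1.
set m := harnack_sigma s p * L.
set kr := (K * Rad `^ (p * s)) `^ (p - 1)^-1.
have kr0 : 0 <= kr by rewrite powR_ge0.
(* This dichotomy explains the constant 1: either the right side is nonpositive, or m exceeds [kr].
   Then K Rad^(ps) <= m^(p-1), the source is absorbed in the energy bounds, and even u >= m is
   obtained. *)
have [mk|km] := leP m kr; first by apply: essinf_ge_nonpos => //; rewrite subr_le0.
have m0 : 0 < m by apply: le_lt_trans km.
have Kr0 : 0 <= K * Rad `^ (p * s) by rewrite mulr_ge0 ?powR_ge0.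
have KRm : K * Rad `^ (p * s) <= m `^ (p - 1).
  have E : kr `^ (p - 1) = K * Rad `^ (p * s) by rewrite /kr -powRrM mulVf ?gt_eqF// powRr1.
  by rewrite -[leLHS]E; apply: le_powR_pos; rewrite ?(ltW km) ?(ltW q0).
(* The pointwise inequalities need a function that is nonnegative at every point. *)
pose v x := Num.max (u x) 0.
have v0 x : 0 <= v x by rewrite le_max lexx orbT.
have mv : measurable_fun setT v by exact: measurable_maxr.
have BU' : eball0 N (Rad / 3) `<=` U.
  by move=> x Bx; apply: BU => e e0; exists x; split; rewrite // /eball/= edistxx.
have p0 : 0 <= p by apply: le_trans (ltW p1).
have WV : Wsp s p U v by exact: Wsp_pos_part.
have superv : weak_super s p K (eball0 N (Rad / 3)) v by exact: weak_super_pos_part.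
have IV : intN A (fun x => v x `^ (p - 1)) = I%:E by rewrite intN_powR_pos_part.
have mI : m `^ (p - 1) * fine (lebN A) <= harnack_sigma (N := N) s p `^ (p - 1) * I.
  rewrite /m powRM ?powR_ge0 ?(ltW sig0)// -mulrA ler_wpM2l ?powR_ge0//.
  rewrite /L -powRrM mulVf ?gt_eqF// powRr1 ?mulr_ge0 ?invr_ge0 ?(ltW a0)//.
  by rewrite mulrC mulrA divff ?mul1r// gt_eqF.
have null := weak_harnack_level N0 s01 p1 Rad0 m0 K0 KRm mv v0 BU' WV superv IV mI.
have sub_le (a b : R) : 0 <= b -> ((a - b)%:E <= a%:E)%E by rewrite lee_fin gerBl.
apply: (le_trans (sub_le m kr kr0)).
apply: ereal_sup_ubound; exists m => //.
apply/eqP; rewrite eq_le lebN_ge0 andbT -[leRHS]null; apply: le_lebN => x [Bx /negP].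
rewrite -ltNge => uxm; rewrite /undershoot_set/=; apply: (@lt_le_trans _ _ m).
  by rewrite gt_max uxm.
rewrite /barrier le_max; apply/orP; left.
(* On the ball of radius Rad / 4 the cone of level 1 is at least 48 m (7/24 - 1/4) - m = m, so
   points with u < m lie in A_1. *)
have e : enorm x / Rad <= 1 / 4.
  by rewrite ler_pdivrMr// mulrC mulrA mulr1 ltW.
have := ler_wpM2l (ltW m0) e; lra.
Qed.
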